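(* Let $p$ be a prime, $n$ a positive integer, $u\in\mathbb{Z}_p^\times$, and let $F_0$ be a maximal abelian finite subgroup of $\mathbb{S}_n$. Let $r_1\ge 1$ be an integer. Then $\widetilde{\mathcal{F}}_u(\mathbb{Q}_p(F_0),\widetilde{F_0},r_1)$ is non-empty if and only if $r_1$ divides $$\begin{cases}1&\text{if } p>2 \text{ with } \zeta_p\notin F_0,\\ p-1&\text{if } p>2\text{ with }\zeta_p\in F_0,\\ 1&\text{if } p=2\text{ with } \zeta_3\notin F_0 \text{ and } u\not\equiv\pm1 \bmod 8,\ \text{or with } \zeta_4\notin F_0,\\ 2&\text{if } p=2 \text{ with } \zeta_4\in F_0\text{ and either } u\equiv\pm1\bmod 8\text{ or }\zeta_3\in F_0.\end{cases}$$
   Context: $\mathbb{D}_n$ is the central division algebra over $\mathbb{Q}_p$ of Hasse invariant $1/n$, $\mathcal{O}_n$ its maximal order, $\mathbb{S}_n=\mathcal{O}_n^\times$. $v$ is the unique valuation on $\mathbb{D}_n$ extending the $p$-adic valuation with $v(p)=1$, so $v(\mathbb{D}_n^\times)=\frac1n\mathbb{Z}$. For a subgroup $F_0$ of $\mathbb{S}_n$, $\mathbb{Q}_p(F_0)$ is the $\mathbb{Q}_p$-subalgebra of $\mathbb{D}_n$ generated by $F_0$ (a cyclotomic field when $F_0$ is finite abelian, hence cyclic), and $\widetilde{F_0}=F_0\times\langle pu\rangle\subset\mathbb{D}_n^\times$. $\widetilde{\mathcal{F}}_u(\mathbb{Q}_p(F_0),\widetilde{F_0},r_1)$ is the set of all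 subgroups $\widetilde{F_1}$ of $\mathbb{Q}_p(F_0)^\times$ which contain $\widetilde{F_0}$ as a subgroup of finite index, such that $v$ induces an injection $\widetilde{F_1}/\widetilde{F_0}\hookrightarrow\frac1n\mathbb{Z}/\mathbb{Z}$ and $|\widetilde{F_1}/\widetilde{F_0}|=r_1$. (Such groups correspond to finite subgroups of $\mathbb{G}_n(u)=\mathbb{D}_n^\times/\langle pu\rangle$ extending $F_0$ by a cyclic group of order $r_1$.) $\zeta_i$ denotes a primitive $i$-th root of unity; $\zeta_i\in F_0$ means that $F_0$ contains an element of order $i$. *)

(* Defs.v *)
From HB Require Import structures.
From mathcomp Require Import all_boot all_order all_algebra all_field.
From mathcomp Require Import boolp classical_sets functions cardinality.

Set Implicit Arguments.
Unset Strict Implicit.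
Unset Printing Implicit Defensive.

Import Order.TTheory GRing.Theory Num.Theory.
Local Open Scope classical_set_scope.
Local Open Scope ring_scope.

(* The p-adic integers, as the inverse limit of the Z/p^k: [res x k] is
   the representative in [0, p^k) of the class of x modulo p^k; the bound is a consequence of the coherence condition. *)
Record padic_int (p : nat) (p_pr : prime p) := PadicInt {
  res :> nat -> nat;
  res_coh : forall k, res k = (res k.+1 %% p ^ k)%N }.

Section PadicInt.
Context (p : nat) (p_pr : prime p).
Local Notation Zp := (padic_int p_pr).

HB.instance Definition _ := gen_eqMixin Zp.
HB.instance Definition _ := gen_choiceMixin Zp.

Lemma padic_intP (x y : Zp) : (forall k, x k = y k) -> x = y.
Proof.
case: x y => [f fP] [g gP] /= /funext fg.
by move: fP gP; rewrite fg => fP gP; congr PadicInt; exact: Prop_irrelevance.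
Qed.

Lemma res_mod (x : Zp) k : (x k %% p ^ k)%N = x k.
Proof. by rewrite (res_coh x k) modn_mod. Qed.

Lemma res_modS (x : Zp) k : (x k.+1 = x k %[mod p ^ k])%N.
Proof. by rewrite res_mod [RHS]res_coh. Qed.

Lemma res_le (x : Zp) i j : (i <= j)%N -> (x j = x i %[mod p ^ i])%N.
Proof.
elim: j => [|j IH]; first by rewrite leqn0 => /eqP->.
rewrite leq_eqVlt => /orP[/eqP->//|]; rewrite ltnS => ij.
by rewrite -IH// -(modn_dvdm (x j.+1) (dvdn_exp2l p ij)) res_modS modn_dvdm ?dvdn_exp2l.
Qed.

Definition coherent (f : nat -> nat) := forall k, (f k.+1 = f k %[mod p ^ k])%N.

Lemma mkpadic_subproof f (cf : coherent f) k :
  (f k %% p ^ k = (f k.+1 %% p ^ k.+1) %% p ^ k)%N.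
Proof. by rewrite modn_dvdm ?dvdn_exp2l// cf. Qed.

Definition mkpadic f (cf : coherent f) : Zp :=
  @PadicInt p p_pr (fun k => (f k %% p ^ k)%N) (mkpadic_subproof cf).

Lemma const_coh n : coherent (fun=> n). Proof. by []. Qed.
Lemma add_coh (x y : Zp) : coherent (fun k => x k + y k)%N.
Proof. by move=> k; rewrite -modnDm !res_modS modnDm. Qed.
Lemma mul_coh (x y : Zp) : coherent (fun k => x k * y k)%N.
Proof. by move=> k; rewrite -modnMm !res_modS modnMm. Qed.
(* [p ^ k - 1] represents [-1] modulo [p ^ k] *)
Lemma opp_coh (x : Zp) : coherent (fun k => (p ^ k).-1 * x k)%N.
Proof.
move=> k; rewrite -modnMm res_modS modnMm; apply/eqP.
have P m : (p ^ m).-1.+1 = (p ^ m)%N by rewrite prednK // expn_gt0 prime_gt0.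
rewrite -(eqn_modDr (x k)) -!(mulSnr _ (x k)) !P.
by rewrite expnS -mulnA mulnCA !modnMr.
Qed.

Definition zp_zero := mkpadic (const_coh 0).
Definition zp_one := mkpadic (const_coh 1).
Definition zp_add x y := mkpadic (add_coh x y).
Definition zp_opp x := mkpadic (opp_coh x).
Definition zp_mul x y := mkpadic (mul_coh x y).

Lemma zp_addA : associative zp_add.
Proof. by move=> x y z; apply: padic_intP => k /=; rewrite modnDmr modnDml addnA. Qed.
Lemma zp_addC : commutative zp_add.
Proof. by move=> x y; apply: padic_intP => k /=; rewrite addnC. Qed.
Lemma zp_add0 : left_id zp_zero zp_add.
Proof. by move=> x; apply: padic_intP => k /=; rewrite mod0n add0n res_mod. Qed.
Lemma zp_addN : left_inverse zp_zero zp_opp zp_add.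
Proof.
move=> x; apply: padic_intP => k /=.
by rewrite modnDml -mulSnr prednK ?expn_gt0 ?prime_gt0// modnMr mod0n.
Qed.
HB.instance Definition _ :=
  GRing.isZmodule.Build Zp zp_addA zp_addC zp_add0 zp_addN.

Lemma zp_mulA : associative zp_mul.
Proof. by move=> x y z; apply: padic_intP => k /=; rewrite modnMmr modnMml mulnA. Qed.
Lemma zp_mulC : commutative zp_mul.
Proof. by move=> x y; apply: padic_intP => k /=; rewrite mulnC. Qed.
Lemma zp_mul1 : left_id zp_one zp_mul.
Proof. by move=> x; apply: padic_intP => k /=; rewrite modnMml mul1n res_mod. Qed.
Lemma zp_mulDl : left_distributive zp_mul zp_add.
Proof. by move=> x y z; apply: padic_intP => k /=; rewrite modnMml modnDm mulnDl. Qed.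
Lemma zp_one_neq0 : zp_one != 0.
Proof.
apply/eqP => /(congr1 (fun x : Zp => x 1%N)) /=.
by rewrite mod0n expn1 modn_small ?prime_gt1.
Qed.
HB.instance Definition _ := GRing.Zmodule_isComNzRing.Build Zp
  zp_mulA zp_mulC zp_mul1 zp_mulDl zp_one_neq0.

Definition zp_unit : pred Zp := fun x => `[< exists y, y * x = 1 >].
Definition zp_inv (x : Zp) : Zp := xget x [set y | y * x = 1].

Lemma zp_mulVx : {in zp_unit, left_inverse 1 zp_inv *%R}.
Proof. by move=> x /asboolP /(xgetPex x). Qed.
Lemma zp_unitP (x y : Zp) : y * x = 1 -> zp_unit x.
Proof. by move=> yx; apply/asboolP; exists y. Qed.
Lemma zp_inv_out : {in [predC zp_unit], zp_inv =1 id}.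
Proof.
move=> x /negP xu; apply: xgetPN => y /zp_unitP; exact: xu.
Qed.
HB.instance Definition _ := GRing.ComNzRing_hasMulInverse.Build Zp
  zp_mulVx zp_unitP zp_inv_out.

Lemma zp_neq0 (x : Zp) : x != 0 -> exists i, ~~ (p ^ i %| x i)%N.
Proof.
apply: contra_neqP => /forallNP xi; apply: padic_intP => k /=.
by rewrite mod0n -res_mod; apply/eqP/negPn/negP; exact: xi.
Qed.

Lemma zp_integral : GRing.integral_domain_axiom Zp.
Proof.
move=> x y xy; apply: contra_eqT (xy); rewrite negb_or => /andP[].
move=> /zp_neq0[i xi] /zp_neq0[j yj].
have P (z : Zp) a b : (a <= b)%N -> ~~ (p ^ a %| z a)%N ->
    (0 < z b)%N /\ (logn p (z b) < a)%N.
  move=> ab za; have zb : ~~ (p ^ a %| z b)%N by rewrite /dvdn (res_le _ ab).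
  have z0 : (0 < z b)%N by case: (z b) zb => //; rewrite dvdn0.
  by split=> //; rewrite ltnNge -pfactor_dvdn.
have [x0 lx] := P _ _ _ (leq_addr j i) xi.
have [y0 ly] := P _ _ _ (leq_addl i j) yj.
apply/eqP => /(congr1 (fun z : Zp => z (i + j)%N)) /=; rewrite mod0n => /eqP.
apply/negP; rewrite -/(dvdn _ _) pfactor_dvdn ?muln_gt0 ?x0// lognM//.
by rewrite -ltnNge -addSn; apply: leq_add => //; exact: ltnW.
Qed.
HB.instance Definition _ := GRing.ComUnitRing_isIntegral.Build Zp zp_integral.

End PadicInt.

Definition padic (p : nat) (p_pr : prime p) := {fraction padic_int p_pr}.
HB.instance Definition _ p p_pr := GRing.Field.on (@padic p p_pr).

Definition zp_to_qp p (p_pr : prime p) (x : padic_int p_pr) : padic p_pr :=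
  @FracField.tofrac (padic_int p_pr) x.

(* a = p^k z with z a unit of Z_p has valuation k; the value at 0 is junk *)
Definition padic_val p (p_pr : prime p) (a : padic p_pr) : int :=
  xget 0 [set k : int | exists2 z : padic_int p_pr,
    z \is a GRing.unit & a = p%:R ^ k * zp_to_qp z].

Lemma res_nat p (p_pr : prime p) m k : (m%:R : padic_int p_pr) k = (m %% p ^ k)%N.
Proof.
elim: m => [|m IH]; first by [].
by rewrite -natr1 [LHS]/= IH modnDml modnDmr addn1.
Qed.

Lemma zp_p_nunit p (p_pr : prime p) : (p%:R : padic_int p_pr) \isn't a GRing.unit.
Proof.
apply/negP => /mulVr /(congr1 (fun z : padic_int p_pr => z 1%N)).
rewrite [LHS]/= res_nat expn1 modnn muln0 mod0n /= modn_small//; exact: prime_gt1.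
Qed.

Lemma padic_valE p (p_pr : prime p) (k : int) (z : padic_int p_pr) :
  z \is a GRing.unit -> padic_val (p%:R ^ k * zp_to_qp z) = k.
Proof.
move=> zu; apply: xget_subset1; first by exists z.
pose f : {rmorphism padic_int p_pr -> padic p_pr} := @FracField.tofrac _.
have fE x : zp_to_qp x = f x by [].
have pf : (p%:R : padic p_pr) = f p%:R by rewrite rmorph_nat.
have f_inj : injective f by move=> x y /eqP; rewrite /f /= tofrac_eq => /eqP.
have p0 : (p%:R : padic_int p_pr) != 0.
  apply/eqP => /(congr1 (fun z : padic_int p_pr => z 2%N)).
  rewrite [LHS]res_nat /= mod0n modn_small => [p0|].
    by move: (prime_gt0 p_pr); rewrite p0.
  by rewrite -{1}(expn1 p) ltn_exp2l ?prime_gt1.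
have P0 : (p%:R : padic p_pr) != 0 by rewrite pf -(rmorph0 f) (inj_eq f_inj).
suff H (i j : int) (x y : padic_int p_pr) : (i < j)%R -> x \is a GRing.unit ->
    p%:R ^ i * zp_to_qp x <> p%:R ^ j * zp_to_qp y.
  move=> i j /= [x xu ->] [y yu] e; case: (ltgtP i j) => // ij.
    by case: (H _ _ _ _ ij xu e).
  by case: (H _ _ _ _ ij yu (esym e)).
move=> ij xu; have [m ->] : exists m : nat, j = i + m.+1%:Z.
  exists (`|j - i|%N.-1); rewrite prednK ?absz_gt0 ?subr_eq0 ?gt_eqF//.
  by rewrite gez0_abs ?subr_ge0 ?ltW// addrCA subrr addr0.
rewrite expfzDr// -mulrA => /(mulfI (expfz_neq0 _ P0)).
rewrite -exprnP !fE pf -rmorphXn -rmorphM => /f_inj ex.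
have := xu; rewrite ex exprS -mulrA unitrM => /andP[+ _].
exact/negP/zp_p_nunit.
Qed.

Definition eqmod_zp p (p_pr : prime p) (m : nat) (a b : padic_int p_pr) :=
  exists c, a = b + m%:R * c.

Section DivisionAlgebra.
Context (p : nat) (p_pr : prime p) (D : falgType (padic p_pr)).
Implicit Types (A F G O : set D) (v : D -> rat) (x y : D).

Definition central_division_algebra :=
  (forall x, x != 0 -> x \is a GRing.unit) /\ ('Z({:D}) = 1)%VS.

(* Valuations of D with values in Q which extend the p-adic one; only the values
   at nonzero elements matter. *)
Definition extends_padic_val v :=
  [/\ forall x y, x != 0 -> y != 0 -> v (x * y) = v x + v y,
      forall x y, x != 0 -> y != 0 -> x + y != 0 ->
        Num.min (v x) (v y) <= v (x + y)
    & forall a : padic p_pr, a != 0 -> v a%:A = (padic_val a)%:~R].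

(* W is a commutative subfield of degree n, with the same value group Z as Q_p; the
   residue field being perfect, no separability condition is needed. *)
Definition unramified_subfield v (n : nat) (W : {aspace D}) :=
  [/\ (W <= 'C(W))%VS, \dim W = n
    & forall w, w \in W -> w != 0 -> v w \is a Num.int].

(* Conjugation by s preserves W and induces on it the Frobenius automorphism,
   i.e. the w |-> w^p map on the residue field. *)
Definition induces_frobenius v (W : {aspace D}) (s : D) :=
  [/\ s != 0,
      forall w, w \in W -> s * w * s^-1 \in W
    & forall w, w \in W -> w != 0 -> 0 <= v w ->
        s * w * s^-1 = w ^+ p \/ 0 < v (s * w * s^-1 - w ^+ p)].

(* For D central of dimension n^2, the Hasse invariant is the class in Q/Z of the valuation
   of an element inducing the Frobenius on an unramified subfield of degree n. *)
Definition has_hasse_invariant v (n : nat) (r : rat) :=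
  exists (W : {aspace D}) (s : D),
    [/\ unramified_subfield v n W, induces_frobenius v W s
      & v s - r \is a Num.int].

Definition zp_span m (b : m.-tuple D) : set D :=
  [set \sum_(i < m) zp_to_qp (z i) *: tnth b i | z in [set: 'I_m -> padic_int p_pr]].

(* a subring which is a finitely generated Z_p-module and spans D over Q_p *)
Definition is_order O :=
  GRing.subring_closed (mem O) /\
  exists m (b : m.-tuple D), O = zp_span b /\ (<<b>> = fullv)%VS.

Definition is_maximal_order O :=
  is_order O /\ forall O', is_order O' -> O `<=` O' -> O' = O.

Definition ring_units O : set D :=
  [set x | [/\ O x, x \is a GRing.unit & O x^-1]].

Definition mul_subgroup G :=
  (forall x, G x -> x \is a GRing.unit) /\ GRing.divr_closed (mem G).

Definition finite_abelian_subgroup_of A F :=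
  [/\ mul_subgroup F, F `<=` A, finite_set F
    & forall x y, F x -> F y -> x * y = y * x].

Definition maximal_finite_abelian_subgroup_of A F :=
  finite_abelian_subgroup_of A F /\
  forall F', finite_abelian_subgroup_of A F' -> F `<=` F' -> F' = F.

Definition has_zeta (i : nat) F := exists2 z, F z & i.-primitive_root z.

(* Q_p(F), the subalgebra generated by F *)
Definition qp_adjoin F : set D :=
  smallest [set A : set D | GRing.subalg_closed (mem A)] F.

(* the subgroup F x <p u> of D^* *)
Definition tilde (u : padic_int p_pr) F : set D :=
  [set x * (zp_to_qp (p%:R * u))%:A ^ k | x in F & k in [set: int]].

Definition coset G x : set D := [set x * g | g in G].
Definition cosets A G : set (set D) := coset G @` A.

(* The set of the subgroups F1 of K^* containing F0t as a subgroup of finite index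
   r1, such that v induces an injection of F1 / F0t into ((1/n)Z) / Z: the equivalence
   says both that v mod Z is well defined on F1 / F0t and that it is injective. *)
Definition calF v (n : nat) (K F0t : set D) (r1 : nat) : set (set D) :=
  [set F1 | [/\ mul_subgroup F1, F1 `<=` K, F0t `<=` F1,
      (forall x, F1 x -> n%:R * v x \is a Num.int) /\
      (forall x y, F1 x -> F1 y ->
         coset F0t x = coset F0t y <-> v x - v y \is a Num.int)
    & (cosets F1 F0t #= `I_r1)%card]].

End DivisionAlgebra.

(* Main.v *)
(* An element of calF is generated over the tilde of F0 by some x in K = Q_p(F0) with
   x^r1 in pu F0: take x of least positive valuation, v(x) = 1/r1. So the question is for
   which r the field K contains an r-th root of an element of pu F0.

   F0 is cyclic, K = K0(z) with K0 generated by the roots of unity of order prime to p and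
   z of order N = p^(a+1) (if p does not divide |F0|, or if p = 2 and 4 does not, K is
   unramified and r = 1). The valuation is integral on K0, and 1 - z has valuation
   1 / phi(N): hence Gal(K / K0) = (Z/N)^*, and r divides phi(N). Further divisors are
   excluded with the relative norm c = x s(x), where s is z |-> z^-1: for x^p in pu <z>
   (p odd) or x^4 in 2u <z> (p = 2), c lies in K0 although v(c) = 2/p, respectively 1/2.
   For p = 2 and x^2 in 2u <z>, u or -u is a square in K0; modulo 8 this forces
   u = +-1 or sqrt(-3) in K0, hence zeta_3 in Z_2[F0], and zeta_3 in F0 by maximality.

   Conversely, for p odd, p / (1 - zeta_p)^(p-1) is -1 modulo 1 - zeta_p, and 1-units of
   Z_p[zeta_p] are (p-1)-th powers; F0 contains the (p-1)-th roots of unity by maximality.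
   For p = 2, (1 + i)^2 = 2i, and u or -u is a square in Q_2 or in Q_2(sqrt(-3)). *)
Require Import Defs.
From HB Require Import structures.
From mathcomp Require Import all_boot all_order all_algebra all_field.
From mathcomp Require Import boolp classical_sets functions cardinality.
From mathcomp Require Import generic_quotient fraction cyclic zify ring lra.

Set Implicit Arguments.
Unset Strict Implicit.
Unset Printing Implicit Defensive.

Import Order.TTheory GRing.Theory Num.Theory.
Local Open Scope classical_set_scope.
Local Open Scope ring_scope.

(** The integrality of v on K0 is drawn from congruences in Z_p[w], where w generates K0: P^q =
    P(X^q) modulo p for P over Z_p, and w^q = w for suitable q = p^f, so y^q = y modulo p on Z_p[w].
    Galois theory over K0 also comes from valuations. A nonzero polynomial in 1 - z of degree below
    phi(N), with coefficients in K0, has terms of distinct valuations, so its value is nonzero; this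
    makes the cyclotomic polynomial of order N irreducible over K0 and provides the automorphisms z
    -> z^k. The valuation of the relative norm c is then read off from c^n = (pu)^2, with n = p or
    4. The dimension n^2 and the Hasse invariant 1/n serve to show that v takes its values in
    (1/n)Z, as the groups to be constructed require. Maximality of F0 concerns units of the order O,
    so a new root of unity has to be placed in O before it can be used. Therefore such roots are
    produced as values at powers of a generator g of F0 of polynomials over Z_p, and Z_p[g^i] is
    contained in O. *)

(** * Congruences between powers in commutative rings *)

Lemma exprD_prime (R : comNzRingType) p (a b : R) : prime p ->
  exists r, (a + b) ^+ p = a ^+ p + b ^+ p + p%:R * (a * b * r).
Proof.
case: p => [|[|p]] // p_pr.
rewrite exprDn big_ord_recl big_ord_recr /= subn0 expr0 mulr1 mulr1n.
rewrite /bump /= add1n subnn expr0 mul1r binn mulr1n.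
suff [r ->] : exists r, \sum_(i < p.+1)
    (a ^+ (p.+2 - (1 + i)) * b ^+ (1 + i)) *+ 'C(p.+2, 1 + i)
    = p.+2%:R * (a * b * r) by exists r; ring.
elim/big_rec: _ => [|i _ _ [r ->]]; first by exists 0; rewrite !mulr0.
have ip : (i < p.+1)%N by [].
have /dvdnP[c ->] : (p.+2 %| 'C(p.+2, 1 + i))%N by rewrite prime_dvd_bin //; lia.
exists (a ^+ (p - i) * b ^+ i * c%:R + r).
have -> : (p.+2 - (1 + i) = (p - i).+1)%N by lia.
rewrite -mulr_natr natrM add1n !exprS; ring.
Qed.

(** The mixed binomial terms contain p * p^(m+1), and the last term p^((m+1)p) contains p^(m+2)
    because p >= 2. *)
Lemma expr_prime_cong (R : comNzRingType) p m (x y c : R) : prime p ->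
  x = y + p%:R ^+ m.+1 * c -> exists d, x ^+ p = y ^+ p + p%:R ^+ m.+2 * d.
Proof.
move=> p_pr ->; have [r ->] := exprD_prime y (p%:R ^+ m.+1 * c) p_pr.
have [q ->] : exists q, p = q.+2 by case: p p_pr => [|[|q]] //; exists q.
set P := q.+2%:R; exists (P ^+ (m.+1 * q + m) * c ^+ q.+2 + y * c * r).
rewrite [(_ * c) ^+ _]exprMn -exprM.
have -> : (m.+1 * q.+2 = m.+2 + (m.+1 * q + m))%N by lia.
rewrite [P ^+ (m.+2 + _)]exprD [P ^+ m.+2]exprS.
by move: (P ^+ m.+1) (P ^+ _) (c ^+ _) (y ^+ _) => A B C E; ring.
Qed.

Lemma expr_primeX_cong (R : comNzRingType) p N (x y c : R) : prime p ->
  x = y + p%:R * c -> exists d, x ^+ (p ^ N) = y ^+ (p ^ N) + p%:R ^+ N.+1 * d.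
Proof.
move=> p_pr xy; elim: N => [|N [d IH]]; first by exists c; rewrite expn0 !expr1.
by have [e] := expr_prime_cong p_pr IH; rewrite -!exprM -!expnSr; exists e.
Qed.

Lemma exprD_cong (R : comNzRingType) (x c d : R) n :
  exists r, (x + c * d) ^+ n = x ^+ n + c * r.
Proof.
elim: n => [|n [r IH]]; first by exists 0; rewrite !expr0 mulr0 addr0.
by exists (x * r + d * x ^+ n + c * d * r); rewrite !exprS IH; ring.
Qed.

(** * p-adic integers *)

Section PadicIntegers.
Context (p : nat) (p_pr : prime p).
Local Notation Zp := (padic_int p_pr).
Implicit Types (x y : Zp).

Lemma res_natX k j : ((p%:R ^+ k : Zp) j = p ^ k %% p ^ j)%N.
Proof. by rewrite -natrX res_nat. Qed.

(** Division by p^k costs k digits: the residue of y modulo p^j is read from that of x modulo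
    p^(j+k). *)
Lemma zp_res0 x k : x k = 0%N -> exists y, x = p%:R ^+ k * y.
Proof.
move=> xk.
have P j : (0 < p ^ j)%N by rewrite expn_gt0 prime_gt0.
have dv j : (p ^ k %| x (j + k)%N)%N.
  by rewrite /dvdn (res_le _ (leq_addl j k)) xk mod0n.
have coh : coherent p (fun j => x (j + k) %/ p ^ k)%N.
  move=> j; apply/eqP; rewrite -(eqn_pmul2r (P k)) !muln_modl -expnD !divnK //.
  by rewrite addSn res_modS.
exists (mkpadic p_pr coh); apply: padic_intP => j.
rewrite [RHS]/= res_natX modnMml modnMmr mulnC divnK //.
by rewrite (res_le _ (leq_addr k j)) res_mod.
Qed.

Lemma zp_congP x y k : x k = y k <-> exists d, x = y + p%:R ^+ k * d.
Proof.
split=> [xy|[d ->]]; last first.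
  by rewrite [LHS]/= res_natX modnn mul0n mod0n addn0 res_mod.
have : (x - y) k = (y - y) k by rewrite /= xy.
rewrite subrr [RHS]/= mod0n => /zp_res0[d xyd]; by exists d; rewrite -xyd addrC subrK.
Qed.

Lemma zp_eq x y : (forall k, exists d, x = y + p%:R ^+ k * d) -> x = y.
Proof. by move=> H; apply: padic_intP => k; apply/zp_congP. Qed.

(** Completeness of Z_p; the limit is given by the diagonal sequence of residues. *)
Lemma zp_lim (f : nat -> Zp) : (forall k, exists d, f k.+1 = f k + p%:R ^+ k * d) ->
  exists y, forall k, exists d, y = f k + p%:R ^+ k * d.
Proof.
move=> H; have coh : coherent p (fun k => f k k).
  by move=> k; have /zp_congP <- := H k; rewrite res_modS.
by exists (mkpadic p_pr coh) => k; apply/zp_congP; rewrite /= res_mod.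
Qed.

Lemma res_expr x k m : (x ^+ m) k = (x k ^ m %% p ^ k)%N.
Proof.
elim: m => [|m IH]; first by rewrite expr0 expn0; exact: (res_nat p_pr 1 k).
by rewrite exprS [LHS]/= IH modnMmr expnS.
Qed.

Lemma zp_expp x : exists c, x ^+ p = x + p%:R * c.
Proof.
suff /zp_congP[c] : (x ^+ p) 1%N = x 1%N by rewrite expr1; exists c.
by rewrite res_expr expn1 fermat_little // -[X in (_ %% X)%N]expn1 res_mod.
Qed.

(** The inverse is the limit of the geometric series in -pc. *)
Lemma zp_unit1 x c : x = 1 + p%:R * c -> x \is a GRing.unit.
Proof.
move=> ->; pose f k := \sum_(i < k) (- (p%:R * c)) ^+ i.
have f1 k : (1 + p%:R * c) * f k = 1 - p%:R ^+ k * (- c) ^+ k.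
  rewrite -exprMn mulrN; have := subrX1 (- (p%:R * c)) k; rewrite -/(f k) => E.
  by rewrite -[RHS]opprB E; ring.
have [|y yP] := zp_lim (f := f).
  by move=> k; exists ((- c) ^+ k); rewrite /f big_ord_recr /= -exprMn mulrN.
apply/unitrPr; exists y; apply: zp_eq => k; have [d ->] := yP k.
by exists ((1 + p%:R * c) * d - (- c) ^+ k); rewrite mulrDr f1; ring.
Qed.

Lemma zp_unitE x : (x \is a GRing.unit) = (x 1%N != 0%N).
Proof.
apply/idP/idP => [xu|/eqP x1].
  apply/eqP => /zp_res0[y].
  by rewrite expr1 => xy; move: xu; rewrite xy unitrM (negPf (zp_p_nunit p_pr)).
have xp := prime_gt0 p_pr.
suff /zp_congP[c] : (x ^+ p.-1) 1%N = (1 : Zp) 1%N.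
  rewrite expr1 => /zp_unit1; rewrite unitrX_pos //.
  by move: (prime_gt1 p_pr); lia.
rewrite res_expr [RHS]/= expn1 -(totient_prime p_pr) Euler_exp_totient //.
rewrite coprime_sym prime_coprime // /dvdn -[X in (_ %% X)%N]expn1 res_mod; exact/eqP.
Qed.

Lemma zp_decomp x : x != 0 ->
  exists k, exists2 y, y \is a GRing.unit & x = p%:R ^+ k * y.
Proof.
move=> x0; have [i xi] := zp_neq0 x0.
have : exists i, x i != 0%N.
  by exists i; apply: contra xi => /eqP ->; rewrite dvdn0.
move=> /ex_minnP[[|k]]; first by rewrite res_coh expn0 modn1.
move=> xk min; have /zp_res0[y xy] : x k = 0%N.
  by apply/eqP/negP => /negP /min; rewrite ltnn.
exists k, y => //; rewrite zp_unitE; apply: contra xk => /eqP /zp_res0[z yz].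
have /zp_congP -> : exists d, x = 0 + p%:R ^+ k.+1 * d.
  by exists z; rewrite xy yz expr1 exprSr mulrA add0r.
by rewrite /= mod0n.
Qed.

(** The root of unity is the limit of x^(p^k). It will correct u by an element of F0 when p is
    odd. *)
Lemma zp_teichmuller x : x \is a GRing.unit ->
  exists t c, t ^+ p.-1 = 1 /\ t = x + p%:R * c.
Proof.
move=> xu; have [c xc] := zp_expp x.
have [|t tP] := zp_lim (f := fun k => x ^+ (p ^ k)).
  move=> k; have [d] := expr_primeX_cong k p_pr xc; rewrite -exprM -expnS => ->.
  by exists (p%:R * d); rewrite exprSr mulrA.
have xt : exists c, t = x + p%:R * c.
  have [d ->] := tP 1%N; rewrite expn1 xc.
  by exists (c + d); rewrite expr1 mulrDr addrA.
have [e te] := xt; exists t, e; split=> //.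
have p1 := prime_gt1 p_pr.
have xp : x * x ^+ p.-1 = x + p%:R * c by rewrite -exprS prednK ?xc //; lia.
have xp1 : x ^+ p.-1 = 1 + p%:R * (x^-1 * c).
  by apply: (mulrI xu); rewrite xp mulrDr mulr1 mulrCA mulVKr.
apply: zp_eq => k; have [d ->] := tP k.
have [f fE] := expr_primeX_cong k p_pr xp1.
have [r ->] := exprD_cong (x ^+ (p ^ k)) (p%:R ^+ k) d p.-1.
rewrite -exprM mulnC exprM fE expr1n; exists (p%:R * f + r); rewrite exprSr; ring.
Qed.

End PadicIntegers.

(** Put s = 1 + 4w. As s^2 = 1 + 8(w + 2w^2), w has to be a fixed point of the contraction w -> b -
    2w^2, whose iterates are [f]. *)
Lemma zp2_sqrt (p_pr : prime 2) (a b : padic_int p_pr) :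
  a = 1 + 8%:R * b -> exists s, s ^+ 2 = a.
Proof.
move=> ->; pose f := fix f k := if k is k'.+1 then b - 2%:R * f k' ^+ 2 else 0.
have fS k : f k.+1 = b - 2%:R * f k ^+ 2 by [].
have [|w wP] := zp_lim (f := f).
  elim=> [|k [d IH]]; first by exists (f 1%N); rewrite expr0 mul1r add0r.
  exists (- (2%:R * f k * d + 2%:R ^+ k * d ^+ 2)).
  rewrite [f k.+2]fS [in LHS]IH [f k.+1]fS [2%:R ^+ k.+1]exprS; ring.
exists (1 + 4%:R * w).
suff wE : w = b - 2%:R * w ^+ 2.
  have -> : b = w + 2%:R * w ^+ 2 by rewrite {1}wE; ring.
  ring.
apply: zp_eq => k; have [d wd] := wP k; have [e we] := wP k.+1.
exists (2%:R * e + 2%:R * (2%:R * f k * d + 2%:R ^+ k * d ^+ 2)).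
rewrite {1}we wd fS [2%:R ^+ k.+1]exprS; ring.
Qed.

(** * The field of p-adic numbers *)

Lemma fraction_frac (R : idomainType) (a : {fraction R}) :
  exists x y : R, y != 0 /\ a * FracField.tofrac y = FracField.tofrac x.
Proof.
elim/quotW: a => r; exists (frac r).1, (frac r).2.
split; first exact: denom_ratioP.
unlock FracField.tofrac; rewrite -[LHS]FracField.pi_mul; apply/eqmodP.
rewrite /= FracField.equivfE /FracField.mulf !numden_Ratio ?mulr1 ?mul1r ?oner_eq0 ?denom_ratioP //.
by rewrite mulrC.
Qed.

Section PadicNumbers.
Context (p : nat) (p_pr : prime p).
Local Notation Zp := (padic_int p_pr).
Local Notation Qp := (padic p_pr).

HB.instance Definition _ := GRing.RMorphism.copy (@zp_to_qp p p_pr)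
  (@FracField.tofrac (padic_int p_pr)).

Local Notation iota := (@zp_to_qp p p_pr).

Lemma zp_to_qp_eq0 (x : Zp) : (iota x == 0) = (x == 0).
Proof. exact: tofrac_eq0. Qed.

Lemma qp_frac (a : Qp) : exists x y : Zp, y != 0 /\ a * iota y = iota x.
Proof. exact: fraction_frac. Qed.

Lemma qp_pM (a : Qp) : exists k (z : Zp), p%:R ^+ k * a = iota z.
Proof.
have [x [y [y0 axy]]] := qp_frac a; have [k [z zu yz]] := zp_decomp y0.
exists k, (x * z^-1); rewrite rmorphM /= -axy -mulrA -[iota y * _]rmorphM yz mulrK //.
by rewrite rmorphXn rmorph_nat mulrC.
Qed.

End PadicNumbers.

(** * Valuations on division rings *)

(** Common to the noncommutative D and to its subfields. The value at 0 is unconstrained, hence the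
    nonvanishing hypotheses. *)
Definition division_valuation (D : unitRingType) (v : D -> rat) :=
  [/\ forall x : D, x != 0 -> x \is a GRing.unit,
      forall x y : D, x != 0 -> y != 0 -> v (x * y) = v x + v y
    & forall x y : D, x != 0 -> y != 0 -> x + y != 0 -> Num.min (v x) (v y) <= v (x + y)].

Section DivisionValuation.
Context (D : unitRingType) (v : D -> rat) (v_val : division_valuation v).
Implicit Types (x y : D).

Let D_unit x : x != 0 -> x \is a GRing.unit.
Proof. by case: v_val => H _ _ /H. Qed.

Lemma div_mulf_neq0 x y : x != 0 -> y != 0 -> x * y != 0.
Proof.
move=> /D_unit xu y0; apply: contraNneq y0 => xy.
by rewrite -(mulKr xu y) xy mulr0.
Qed.

Lemma div_expf_neq0 x n : x != 0 -> x ^+ n != 0.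
Proof.
by move=> x0; elim: n => [|n IH]; rewrite ?expr0 ?oner_neq0 // exprS div_mulf_neq0.
Qed.

Lemma pvalM x y : x != 0 -> y != 0 -> v (x * y) = v x + v y.
Proof. by case: v_val => _ H _; exact: H. Qed.

Lemma pval1 : v 1 = 0.
Proof. have := pvalM (oner_neq0 D) (oner_neq0 D); rewrite mulr1; lra. Qed.

Lemma pvalX x n : x != 0 -> v (x ^+ n) = n%:R * v x.
Proof.
move=> x0; elim: n => [|n IH]; first by rewrite expr0 mul0r pval1.
by rewrite exprS pvalM ?div_expf_neq0 // IH -natr1; lra.
Qed.

Lemma pvalV x : x != 0 -> v x^-1 = - v x.
Proof.
move=> x0; have xu := D_unit x0.
have xV : x^-1 != 0 by apply: contraTneq xu; rewrite -unitrV => ->; rewrite unitr0.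
by have := pvalM x0 xV; rewrite divrr // pval1; lra.
Qed.

Lemma pvalXz x (k : int) : x != 0 -> v (x ^ k) = k%:~R * v x.
Proof.
move=> x0; case: k => n; first by rewrite -exprnP pvalX.
by rewrite NegzE -exprnN pvalV ?div_expf_neq0 // pvalX // mulrNz mulNr.
Qed.

Lemma pval_root1 x n : (0 < n)%N -> x ^+ n = 1 -> v x = 0.
Proof.
move=> n0 xn; have x0 : x != 0.
  by apply/eqP => x0; move/eqP: xn; rewrite x0 expr0n eqn0Ngt n0 eq_sym oner_eq0.
have := pvalX n x0; rewrite xn pval1 => /esym/eqP.
by rewrite mulf_eq0 pnatr_eq0 eqn0Ngt n0 => /eqP.
Qed.

Lemma pvalN x : v (- x) = v x.
Proof.
have [->|x0] := eqVneq x 0; first by rewrite oppr0.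
have N1 : (- 1 : D) != 0 by rewrite oppr_eq0 oner_eq0.
by rewrite -mulN1r pvalM // (@pval_root1 _ 2) ?add0r // sqrrN expr1n.
Qed.

Lemma pvalD x y : x != 0 -> y != 0 -> x + y != 0 -> Num.min (v x) (v y) <= v (x + y).
Proof. by case: v_val => _ _ H; exact: H. Qed.

Lemma pvalD_ge x y c : (x != 0 -> c <= v x) -> (y != 0 -> c <= v y) ->
  x + y != 0 -> c <= v (x + y).
Proof.
have [->|x0] := eqVneq x 0; first by rewrite add0r => _ H /H.
have [->|y0] := eqVneq y 0; first by rewrite addr0 => H _ _; exact: H.
move=> /(_ isT) cx /(_ isT) cy xy; apply: le_trans (pvalD x0 y0 xy).
by rewrite le_min cx.
Qed.

Lemma pvalD_lt x y : x != 0 -> y != 0 -> v x < v y -> x + y != 0 /\ v (x + y) = v x.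
Proof.
move=> x0 y0 xy; have xy0 : x + y != 0.
  by apply/eqP => /addr0_eq xyE; move: xy; rewrite -xyE pvalN ltxx.
split=> //; apply/eqP; rewrite eq_le; apply/andP; split.
  have Ny : - y != 0 by rewrite oppr_eq0.
  have := pvalD xy0 Ny; rewrite addrK pvalN => /(_ x0).
  by rewrite ge_min [v y <= _]leNgt xy orbF.
by have := pvalD x0 y0 xy0; rewrite (min_idPl (ltW xy)).
Qed.

Lemma pvalD_neq x y : x != 0 -> y != 0 -> v x != v y ->
  x + y != 0 /\ (v (x + y) = v x \/ v (x + y) = v y).
Proof.
move=> x0 y0; rewrite neq_lt => /orP[] xy.
  by have [? ->] := pvalD_lt x0 y0 xy; split=> //; left.
by rewrite addrC; have [? ->] := pvalD_lt y0 x0 xy; split=> //; right.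
Qed.

(** Terms of distinct valuations cannot cancel. This yields independence twice: for the powers of 1
    - z over K0, and for the summands W s^i of D. *)
Lemma pval_sum_distinct (I : eqType) (r : seq I) (t : I -> D) : uniq r ->
  {in r &, forall i j, t i != 0 -> t j != 0 -> v (t i) = v (t j) -> i = j} ->
  {in r, forall i, t i = 0} \/
  \sum_(i <- r) t i != 0 /\
    exists i, [/\ i \in r, t i != 0 & v (\sum_(i <- r) t i) = v (t i)].
Proof.
elim: r => [|i r IH] /=; first by left.
move=> /andP[ir ur] H; have rS : {subset r <= i :: r}.
  by move=> j; rewrite inE orbC => ->.
have [|Z|[S0 [j [jr tj vj]]]] := IH ur.
- by move=> j k jr kr; apply: H; exact: rS.
- rewrite big_cons big_seq big1 // addr0.
  have [ti|ti] := eqVneq (t i) 0.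
    by left=> j; rewrite inE => /orP[/eqP->|/Z].
  by right; split=> //; exists i; rewrite mem_head.
rewrite big_cons; right; have [ti|ti] := eqVneq (t i) 0.
  by rewrite ti add0r; split=> //; exists j; split=> //; exact: rS.
have [|X0 [X|X]] := pvalD_neq ti S0.
- rewrite vj; apply: contra ir => /eqP vij.
  by rewrite (H i j) ?mem_head ?rS.
- by split=> //; exists i; rewrite mem_head.
- by split=> //; exists j; rewrite X vj; split=> //; exact: rS.
Qed.

End DivisionValuation.

Lemma qp_p_neq0 (p : nat) (p_pr : prime p) : (p%:R : padic p_pr) != 0.
Proof.
apply/eqP => p0; have := padic_valE 1 (unitr1 (padic_int p_pr)).
have := padic_valE 2 (unitr1 (padic_int p_pr)).
by rewrite p0 !exp0rz /= !mul0r => -> /eqP.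
Qed.

Section ExtendsPadicVal.
Context (p : nat) (p_pr : prime p).
Local Notation Zp := (padic_int p_pr).
Local Notation Qp := (padic p_pr).
Local Notation iota := (@zp_to_qp p p_pr).
Context (D : falgType Qp).
Context (v : D -> rat) (v_ext : extends_padic_val v).

Lemma alg_neq0 (a : Qp) : a != 0 -> a%:A != 0 :> D.
Proof. by move=> a0; rewrite scaler_eq0 negb_or a0 oner_neq0. Qed.

Lemma p_neq0 : (p%:R : D) != 0.
Proof. by rewrite -[p%:R]scaler_nat alg_neq0 // qp_p_neq0. Qed.

Lemma pval_p : v p%:R = 1.
Proof.
rewrite -[p%:R]scaler_nat; case: v_ext => _ _ ->; last exact: (qp_p_neq0 p_pr).
have := padic_valE 1 (unitr1 Zp); rewrite expr1z.
have -> : iota 1 = 1 by exact: rmorph1.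
by rewrite mulr1 => ->.
Qed.

Lemma pval_zp_ge0 (z : Zp) : z != 0 -> 0 <= v (iota z)%:A.
Proof.
move=> /zp_decomp[k [y yu ->]]; case: v_ext => _ _ ->; last first.
  rewrite zp_to_qp_eq0 mulf_neq0 ?expf_neq0 //; last first.
    by apply: contraTneq yu => ->; rewrite unitr0.
  by have := qp_p_neq0 p_pr; rewrite -(rmorph_nat iota) zp_to_qp_eq0.
have -> : iota (p%:R ^+ k * y) = p%:R ^ (k : int) * iota y.
  by rewrite rmorphM rmorphXn rmorph_nat.
by rewrite padic_valE // ler0z.
Qed.

Lemma extends_padic_val_division : (forall x : D, x != 0 -> x \is a GRing.unit) ->
  division_valuation v.
Proof. by case: v_ext. Qed.

End ExtendsPadicVal.

(** * Unramified extensions *)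

Section Frobenius.
Context (p : nat) (p_pr : prime p).
Local Notation Zp := (padic_int p_pr).
Implicit Types (P : {poly Zp}).

(** The p-th power is additive modulo p and fixes the coefficients modulo p, the residue field of
    Z_p being F_p. *)
Lemma zp_poly_frobenius P : exists R, P ^+ p = P \Po 'X^p + p%:R * R.
Proof.
elim/poly_ind: P => [|P c [R IH]].
  by exists 0; rewrite comp_poly0 mulr0 addr0 expr0n eqn0Ngt prime_gt0.
have [r ->] := exprD_prime (P * 'X) c%:P p_pr.
have [d cd] := zp_expp c.
exists (R * 'X^p + d%:P + P * 'X * c%:P * r).
rewrite exprMn IH -polyC_exp cd comp_poly_MXaddC polyCD polyCM.
by rewrite polyC_natr; ring.
Qed.

Lemma zp_poly_frobeniusX P f : exists R, P ^+ (p ^ f) = P \Po 'X^(p ^ f) + p%:R * R.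
Proof.
elim: f => [|f [R IH]].
  by exists 0; rewrite expn0 !expr1 mulr0 addr0 comp_polyXr.
have [d E] := expr_primeX_cong 1 p_pr IH.
have [S ES] := zp_poly_frobenius (P \Po 'X^(p ^ f)).
exists (S + p%:R * d); move: E; rewrite expn1 -exprM -expnSr ES => ->.
by rewrite -comp_polyA comp_Xn_poly -exprM mulnC -expnSr expr2; ring.
Qed.

End Frobenius.

(* F stands for Q_p: these are the only properties of Q_p and of Z_p -> L that are used. *)
Record zp_field_ext (p : nat) (p_pr : prime p) (F : fieldType) (L : fieldExtType F)
    (j : padic_int p_pr -> L) (v : L -> rat) : Prop := ZpFieldExt {
  zpf_val : division_valuation v;
  zpf_p0 : p%:R != 0 :> L;
  zpf_vp : v p%:R = 1;
  zpf_ge0 : forall z, j z != 0 -> 0 <= v (j z);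
  zpf_frac : forall a : F, exists k z, p%:R ^+ k * a%:A = j z;
  zpf_base : forall z, j z \in 1%VS }.

Section Unramified.
Context (p : nat) (p_pr : prime p).
Local Notation Zp := (padic_int p_pr).
Context (F : fieldType) (L : fieldExtType F) (j : {rmorphism Zp -> L}) (v : L -> rat).
Context (Lv : zp_field_ext j v).

Let vL : division_valuation v := zpf_val Lv.
Let p0 : p%:R != 0 :> L := zpf_p0 Lv.

Lemma zpf_unit (u : Zp) : u \is a GRing.unit -> j u != 0 /\ v (j u) = 0.
Proof.
move=> uu; have E : j u * j u^-1 = 1 by rewrite -rmorphM divrr // rmorph1.
have /andP[u0 V0] : (j u != 0) && (j u^-1 != 0).
  by rewrite -negb_or -mulf_eq0 E oner_eq0.
split=> //; have := congr1 v E; rewrite (pvalM vL) // (pval1 vL).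
by have := zpf_ge0 Lv u0; have := zpf_ge0 Lv V0; lra.
Qed.

(** The elements of Z_p[w] are handled through polynomials representing them, so that congruences
    between polynomials specialize. *)
Definition zp_eval (w : L) (P : {poly Zp}) : L := (map_poly j P).[w].

HB.instance Definition _ (w : L) :=
  GRing.RMorphism.copy (zp_eval w) (horner_eval w \o map_poly j).

Lemma zp_evalC w c : zp_eval w c%:P = j c.
Proof. by rewrite /zp_eval map_polyC hornerC. Qed.
Lemma zp_evalX w : zp_eval w 'X = w.
Proof. by rewrite /zp_eval map_polyX hornerX. Qed.

Lemma zp_evalD w : {morph zp_eval w : P Q / P + Q}. Proof. exact: rmorphD. Qed.
Lemma zp_evalB w : {morph zp_eval w : P Q / P - Q}. Proof. exact: rmorphB. Qed.
Lemma zp_evalM w : {morph zp_eval w : P Q / P * Q}. Proof. exact: rmorphM. Qed.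
Lemma zp_evalXn w n : {morph zp_eval w : P / P ^+ n}. Proof. exact: rmorphXn. Qed.
Lemma zp_eval1 w : zp_eval w 1 = 1. Proof. exact: rmorph1. Qed.
Lemma zp_eval_nat w n : zp_eval w n%:R = n%:R. Proof. exact: rmorph_nat. Qed.

Lemma zp_eval_ge0 w P : v w = 0 -> zp_eval w P != 0 -> 0 <= v (zp_eval w P).
Proof.
move=> vw; elim/poly_ind: P => [|P c IH]; first by rewrite rmorph0 eqxx.
rewrite rmorphD rmorphM /= zp_evalC zp_evalX.
apply: (pvalD_ge vL); last first.
  exact: zpf_ge0.
rewrite mulf_eq0 negb_or => /andP[P0 w0].
by rewrite (pvalM vL) // vw addr0 IH.
Qed.

Context (m : nat) (w : L) (m_gt0 : (0 < m)%N) (pm : coprime p m) (wm : w ^+ m = 1).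
Local Notation ev := (zp_eval w).

(** The exponent can be taken arbitrarily large, since [unramified_root1] needs p^f >= M. *)
Lemma frobenius_order M : (0 < M)%N ->
  exists f, (M <= f)%N /\ (p ^ f = 1 %[mod m])%N.
Proof.
move=> M0; exists (totient m * M)%N; split.
  by rewrite leq_pmull // totient_gt0.
by rewrite expnM -modnXm Euler_exp_totient // modnXm exp1n.
Qed.

(** As w^(p^f) = w, the f-th iterate of Frobenius is the identity on Z_p[w] modulo p; in particular
    this quotient is reduced. *)
Lemma zp_eval_frobenius f P : (p ^ f = 1 %[mod m])%N ->
  exists R, ev P ^+ (p ^ f) = ev P + p%:R * ev R.
Proof.
move=> fm; have [R ER] := zp_poly_frobeniusX P f; exists R.
rewrite -rmorphXn ER rmorphD rmorphM rmorph_nat /=; congr (_ + _).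
rewrite /zp_eval map_comp_poly map_polyXn horner_comp hornerXn.
by rewrite -(expr_mod _ wm) fm (expr_mod _ wm) expr1.
Qed.

(* If y^q = y + p a, then y (1 - y^(q-1)) = - p a: when v(y) > 0, the element a of Z_p[w]
   has valuation v(y) - 1. *)
Lemma zp_eval_val_int P : ev P != 0 -> v (ev P) \is a Num.int.
Proof.
have vw : v w = 0 by exact: (pval_root1 vL m_gt0 wm).
have [f [f0 fm]] := frobenius_order (ltn0Sn 0).
have q1 : (1 < p ^ f)%N by rewrite -(expn0 p) ltn_exp2l // prime_gt1.
move=> P0; have [k] : exists k : nat, v (ev P) < k%:R.
  exists (Num.bound `|v (ev P)|); apply: le_lt_trans (ler_norm _) _.
  exact/archi_boundP/normr_ge0.
elim: k P P0 => [|k IH] P P0 vk.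
  by have := zp_eval_ge0 vw P0; rewrite leNgt vk.
have := zp_eval_ge0 vw P0; rewrite le_eqVlt => /orP[/eqP <-|vP]; first exact: int_num0.
have [R ER] := zp_eval_frobenius P fm.
have E : ev P * (1 - ev P ^+ (p ^ f).-1) = - (p%:R * ev R).
  rewrite mulrBr mulr1 -exprS prednK ?ER; last by lia.
  by ring.
have [||A0 vA] := @pvalD_lt _ _ vL 1 (- ev P ^+ (p ^ f).-1) (oner_neq0 _).
- by rewrite oppr_eq0 expf_neq0.
- rewrite (pvalN vL) (pval1 vL) (pvalX vL) //.
  by rewrite mulr_gt0 // ltr0n; lia.
have R0 : ev R != 0.
  by apply/eqP => R0; have := mulf_neq0 P0 A0; rewrite E R0 mulr0 oppr0 eqxx.
have : v (ev P) = 1 + v (ev R).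
  have := congr1 v E; rewrite (pvalM vL) // vA (pval1 vL) addr0 => ->.
  by rewrite (pvalN vL) (pvalM vL) ?p0 // (zpf_vp Lv).
move=> vPR; rewrite vPR rpredD ?int_num1 // IH //.
by move: vk; rewrite vPR -natr1; lra.
Qed.

Lemma unramified_zp_eval x : x \in <<1; w>>%VS ->
  exists k P, p%:R ^+ k * x = ev P.
Proof.
move=> /Fadjoin1_polyP[P ->]; elim/poly_ind: P => [|P c [k [R E]]].
  by exists 0%N, 0; rewrite rmorph0 horner0 mulr0 rmorph0.
have [i [z Ez]] := zpf_frac Lv c.
exists (k + i)%N, ((p%:R ^+ i)%:P * R * 'X + (p%:R ^+ k * z)%:P).
have -> : (map_poly (in_alg L) (P * 'X + c%:P)).[w]
    = (map_poly (in_alg L) P).[w] * w + c%:A.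
  by rewrite rmorphD rmorphM /= map_polyX map_polyC hornerMXaddC.
rewrite rmorphD !rmorphM /= zp_evalX !zp_evalC -E.
rewrite exprD -Ez -!natrX !rmorph_nat.
by move: (_ ^ k)%:R (_ ^ i)%:R (_.[w]) (c%:A : L) => a b y d; ring.
Qed.

Lemma unramified_val_int x : x \in <<1; w>>%VS -> x != 0 -> v x \is a Num.int.
Proof.
move=> /unramified_zp_eval[k [P E]] x0.
have pk0 : p%:R ^+ k != 0 :> L by rewrite expf_neq0 // p0.
have P0 : ev P != 0 by rewrite -E mulf_neq0.
have := zp_eval_val_int P0; rewrite -E (pvalM vL) // (pvalX vL) ?p0 //.
by rewrite (zpf_vp Lv) mulr1 => H; rewrite -(addKr k%:R (v x)) rpredD // rpredN natr_int.
Qed.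

(* Z_p[w] is reduced modulo p, so that p^k x, whose M-th power is divisible by p, is
   itself divisible by p. *)
Lemma unramified_root1 x M : x \in <<1; w>>%VS -> (0 < M)%N -> x ^+ M = 1 ->
  exists P, x = ev P.
Proof.
move=> xw M0 xM; have [k [P E]] := unramified_zp_eval xw.
elim: k P E => [|k IH] P E; first by exists P; rewrite -E expr0 mul1r.
have [f [Mf fm]] := frobenius_order M0.
have [R ER] := zp_eval_frobenius P fm.
have Mq : (M <= p ^ f)%N.
  by apply: leq_trans Mf (ltnW (ltn_expl _ (prime_gt1 p_pr))).
have EM : ev P ^+ M = p%:R * (p%:R ^+ (k.+1 * M).-1).
  by rewrite -E exprMn xM mulr1 -exprM -exprS prednK // muln_gt0.
apply: (IH ((p%:R ^+ (k.+1 * M).-1) * P ^+ (p ^ f - M) - R)).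
apply: (mulfI p0); rewrite mulrA -exprS E rmorphB rmorphM !rmorphXn rmorph_nat /=.
rewrite mulrBr mulrA -EM -exprD subnKC // ER; ring.
Qed.

End Unramified.

Lemma ltn_int_multiple_eq (i j e : nat) (x : rat) : (i < e)%N -> (j < e)%N ->
  x \is a Num.int -> i%:R = j%:R + e%:R * x -> i = j.
Proof.
move=> ie je /intrP[k ->] ijk.
have {}ijk : (i : int) = (j : int) + (e : int) * k.
  by apply: (intr_inj (R := rat)); rewrite rmorphD rmorphM.
have [k0|k0|k0] := ltgtP k 0; nia.
Qed.

(** * Adjoining roots of unity of p-power order *)

Section PrimePowerCyclotomic.
Context (L : fieldType) (p a : nat) (p_pr : prime p).
Local Notation N := (p ^ a.+1)%N.
Local Notation e := (totient N).
Context (z : L) (z_prim : N.-primitive_root z).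

(** The cyclotomic polynomial of order p^(a+1), in the form Phi_p(X^(p^a)). *)
Definition prime_power_cyclotomic : {poly L} := \sum_(i < p) 'X^(i * p ^ a).
Local Notation Psi := prime_power_cyclotomic.

Let totE : e = (p.-1 * p ^ a)%N.
Proof. by rewrite totient_pfactor. Qed.

Let pa_gt0 : (0 < p ^ a)%N. Proof. by rewrite expn_gt0 prime_gt0. Qed.

Lemma prime_power_cyclotomicM : ('X^(p ^ a) - 1) * Psi = 'X^N - 1.
Proof.
rewrite expnSr exprM [RHS]subrX1; congr (_ * _).
by apply: eq_bigr => i _; rewrite -exprM mulnC.
Qed.

Lemma size_prime_power_cyclotomic : size Psi = e.+1.
Proof.
have N0 : (0 < N)%N by rewrite expn_gt0 prime_gt0.
have P0 : Psi != 0.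
  apply/eqP => P0; have := size_XnsubC (1 : L) N0.
  by rewrite -prime_power_cyclotomicM P0 mulr0 size_poly0.
have := size_XnsubC (1 : L) N0; rewrite -prime_power_cyclotomicM size_mul //; last first.
  by rewrite -size_poly_eq0 size_XnsubC.
rewrite size_XnsubC // totE expnS => H.
have E : (p * p ^ a = p.-1 * p ^ a + p ^ a)%N by rewrite -mulSnr prednK ?prime_gt0.
by move: H; rewrite E addSn /= addnC -addSn => /addIn ->.
Qed.

Lemma monic_prime_power_cyclotomic : Psi \is monic.
Proof.
have N0 : (0 < N)%N by rewrite expn_gt0 prime_gt0.
have := monicXnsubC (1 : L) N0; rewrite -prime_power_cyclotomicM.
by rewrite monicMl; last exact: (monicXnsubC 1 pa_gt0).
Qed.

Lemma horner1_prime_power_cyclotomic : Psi.[1] = p%:R.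
Proof.
rewrite horner_sum (eq_bigr (fun=> 1)) ?sumr_const ?card_ord // => i _.
by rewrite hornerXn expr1n.
Qed.

Lemma root_prime_power_cyclotomic k : coprime k p -> root Psi (z ^+ k).
Proof.
move=> kp; have kN : coprime k N by rewrite coprime_pexpr.
have zk : N.-primitive_root (z ^+ k) by rewrite (prim_root_exp_coprime _ z_prim).
have := congr1 (fun P => P.[z ^+ k]) prime_power_cyclotomicM.
rewrite hornerM !hornerE (prim_expr_order zk) subrr => /eqP.
rewrite mulf_eq0 subr_eq0 -(prim_order_dvd zk) => /orP[|//].
by move=> /(dvdn_leq pa_gt0); rewrite leqNgt ltn_exp2l ?prime_gt1 // ltnSn.
Qed.

Definition coprime_roots := [seq z ^+ k | k <- iota 0 N & coprime k p].

Lemma uniq_coprime_roots : uniq coprime_roots.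
Proof.
rewrite map_inj_in_uniq ?filter_uniq ?iota_uniq // => i j.
rewrite !mem_filter !mem_iota !add0n => /andP[_ iN] /andP[_ jN] /eqP.
by rewrite (eq_prim_root_expr z_prim) !modn_small // => /eqP.
Qed.

Lemma size_coprime_roots : size coprime_roots = e.
Proof.
rewrite size_map size_filter totient_count_coprime -sum1_count.
rewrite big_mkcond /index_iota subn0; apply: eq_bigr => k _.
by rewrite coprime_sym coprime_pexpl.
Qed.

Lemma root_coprime_roots : all (root Psi) coprime_roots.
Proof.
apply/allP => x /mapP[k]; rewrite mem_filter => /andP[kp _] ->.
exact: root_prime_power_cyclotomic.
Qed.

Lemma prime_power_cyclotomicE : Psi = \prod_(x <- coprime_roots) ('X - x%:P).
Proof.
rewrite {1}(@all_roots_prod_XsubC _ Psi coprime_roots) //.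
- by rewrite (eqP monic_prime_power_cyclotomic) scale1r.
- by rewrite size_prime_power_cyclotomic size_coprime_roots.
- exact: root_coprime_roots.
- by rewrite uniq_rootsE uniq_coprime_roots.
Qed.

Lemma prod_coprime_roots : p%:R = \prod_(x <- coprime_roots) (1 - x).
Proof.
rewrite -horner1_prime_power_cyclotomic prime_power_cyclotomicE horner_prod.
by apply: eq_bigr => x _; rewrite !hornerE.
Qed.

End PrimePowerCyclotomic.

(** * Ramification and Galois theory of K0(z) over K0 *)

Section Ramified.
Context (p : nat) (p_pr : prime p).
Local Notation Zp := (padic_int p_pr).
Context (F : fieldType) (L : fieldExtType F) (j : {rmorphism Zp -> L}) (v : L -> rat).
Context (Lv : zp_field_ext j v).
Context (m : nat) (w : L) (m_gt0 : (0 < m)%N) (pm : coprime p m) (wm : w ^+ m = 1).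
Context (a : nat) (z : L).
Local Notation N := (p ^ a.+1)%N.
Local Notation e := (totient N).
Context (z_prim : N.-primitive_root z).

Let vL : division_valuation v := zpf_val Lv.
Let p0 : p%:R != 0 :> L := zpf_p0 Lv.
Let K0 : {subfield L} := <<1; w>>%AS.
Let pi := 1 - z.

Lemma val_geom_root1 x n k : (0 < n)%N -> x ^+ n = 1 -> 1 - x ^+ k != 0 ->
  v (1 - x) <= v (1 - x ^+ k).
Proof.
move=> n0 xn xk; have x0 : x != 0.
  by apply/eqP => x0; move/eqP: xn; rewrite x0 expr0n eqn0Ngt n0 eq_sym oner_eq0.
have vx := pval_root1 vL n0 xn.
have E : 1 - x ^+ k = (1 - x) * \sum_(i < k) x ^+ i.
  by rewrite -[LHS]opprB subrX1 -mulNr opprB.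
have [x1 s0] : 1 - x != 0 /\ \sum_(i < k) x ^+ i != 0.
  by move: xk; rewrite E mulf_eq0 negb_or => /andP[].
rewrite E (pvalM vL) // lerDl.
elim: k {xk E} s0 => [|k IH]; first by rewrite big_ord0 eqxx.
rewrite big_ord_recr; apply: (pvalD_ge vL) => [/IH //|_].
by rewrite (pvalX vL) // vx mulr0.
Qed.

Lemma pi_neq0 : pi != 0.
Proof.
rewrite subr_eq0 eq_sym -[z]expr1 -(prim_order_dvd z_prim) dvdn1.
by rewrite -(expn0 p) eqn_exp2l ?prime_gt1.
Qed.

Let N_gt0 : (0 < N)%N. Proof. by rewrite expn_gt0 prime_gt0. Qed.
Let e_gt0 : (0 < e)%N. Proof. by rewrite totient_gt0. Qed.

(** [z] and [z ^+ k] are powers of each other, so 1 - z and 1 - z^k divide each other with integral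
    quotients. *)
Lemma val_1Broot k : coprime k p -> v (1 - z ^+ k) = v pi.
Proof.
move=> kp; have zk : N.-primitive_root (z ^+ k).
  by rewrite (prim_root_exp_coprime _ z_prim) coprime_pexpr.
have zk1 : 1 - z ^+ k != 0.
  rewrite subr_eq0 eq_sym -[z ^+ k]expr1 -(prim_order_dvd zk) dvdn1.
  by rewrite -(expn0 p) eqn_exp2l ?prime_gt1.
have [i zE] := prim_rootP zk (prim_expr_order z_prim).
apply/eqP; rewrite eq_le; apply/andP; split; last first.
  exact: val_geom_root1 N_gt0 (prim_expr_order z_prim) zk1.
rewrite /pi {2}zE; apply: (@val_geom_root1 _ N) => //; first exact: prim_expr_order.
by rewrite -zE; exact: pi_neq0.
Qed.

(** p is the product of the phi(N) factors 1 - z^k with k prime to p, which all have the same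
    valuation. *)
Lemma val_pi : e%:R * v pi = 1.
Proof.
transitivity (v p%:R); last exact: zpf_vp Lv.
rewrite (prod_coprime_roots p_pr z_prim) -(size_coprime_roots p a z).
have : {in coprime_roots p a z, forall x, 1 - x != 0 /\ v (1 - x) = v pi}.
  move=> x /mapP[k]; rewrite mem_filter => /andP[kp _] ->; split; last exact: val_1Broot.
  rewrite subr_eq0 eq_sym -(prim_order_dvd z_prim); apply/negP => Nk.
  have pk : (p %| k)%N by apply: dvdn_trans Nk; rewrite expnS dvdn_mulr.
  by move: kp; rewrite coprime_sym prime_coprime // pk.
elim: (coprime_roots _ _ _) => [|x s IH] H.
  by rewrite big_nil mul0r (pval1 vL).
have [x0 vx] := H x (mem_head _ _).
have {}IH := IH (fun y ys => H y (@mem_behead _ (x :: s) _ ys)).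
have s0 : \prod_(y <- s) (1 - y) != 0.
  rewrite prodf_seq_neq0; apply/allP => y ys; apply/implyP => _.
  by have [] := H y (@mem_behead _ (x :: s) _ ys).
by rewrite big_cons (pvalM vL) // -IH vx -natr1; ring.
Qed.

Let K0_int x : x \in K0 -> x != 0 -> v x \is a Num.int.
Proof. exact: (unramified_val_int Lv m_gt0 pm wm). Qed.

(** Coefficients have integral valuation, so e times the valuation of the i-th nonzero term is i
    modulo e. As i < e, these values are distinct. *)
Lemma horner_pi_val (Q : {poly L}) : Q \is a polyOver K0 -> Q != 0 -> (size Q <= e)%N ->
  Q.[pi] != 0 /\
  exists i x, [/\ (i < e)%N, x \is a Num.int & e%:R * v Q.[pi] = i%:R + e%:R * x].
Proof.
move=> /polyOverP QK Q0 Qe; rewrite horner_coef.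
have ev (i : nat) : Q`_i != 0 -> e%:R * v (Q`_i * pi ^+ i) = i%:R + e%:R * v Q`_i.
  move=> Qi; rewrite (pvalM vL) ?expf_neq0 ?pi_neq0 // (pvalX vL) ?pi_neq0 //.
  by rewrite mulrDr mulrCA val_pi mulr1 addrC.
have [|Z|[-> [i [_ ti ->]]]] := pval_sum_distinct vL
  (t := fun i : 'I_(size Q) => Q`_i * pi ^+ i) (index_enum_uniq _).
- move=> i k _ _; rewrite !mulf_eq0 !negb_or => /andP[i0 _] /andP[k0 _] ik.
  apply/val_inj/(@ltn_int_multiple_eq _ _ e (v Q`_k - v Q`_i)).
  + exact: leq_trans (ltn_ord i) Qe.
  + exact: leq_trans (ltn_ord k) Qe.
  + by rewrite rpredB ?K0_int.
  + by have := ev _ i0; rewrite ik (ev _ k0); lra.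
- have Q1 : ((size Q).-1 < size Q)%N by rewrite prednK ?size_poly_gt0.
  have /eqP := Z (Ordinal Q1) (mem_index_enum _).
  rewrite mulf_eq0 expf_eq0 (negPf pi_neq0) andbF orbF.
  by rewrite -/(lead_coef Q) lead_coef_eq0 (negPf Q0).
split=> //; exists i, (v Q`_i); have Qi : Q`_i != 0.
  by move: ti; rewrite mulf_eq0 negb_or => /andP[].
split; [exact: leq_trans (ltn_ord i) Qe | exact: K0_int | exact: ev].
Qed.

Lemma horner_zeta_val (Q : {poly L}) : Q \is a polyOver K0 -> Q != 0 -> (size Q <= e)%N ->
  Q.[z] != 0 /\
  exists i x, [/\ (i < e)%N, x \is a Num.int & e%:R * v Q.[z] = i%:R + e%:R * x].
Proof.
move=> QK Q0 Qe; have s2 : size (1 - 'X : {poly L}) = 2%N.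
  by rewrite -size_polyN opprB size_XsubC.
have zE : z = (1 - 'X).[pi] by rewrite !hornerE /pi opprB addrCA subrr addr0.
rewrite zE -horner_comp; apply: horner_pi_val.
- by rewrite polyOver_comp // rpredB ?rpred1 ?polyOverX.
- by rewrite -size_poly_gt0 size_comp_poly2 // size_poly_gt0.
- by rewrite size_comp_poly2.
Qed.

(** A proper divisor has size at most e, so by [horner_zeta_val] it cannot vanish at [z]. The
    extension is thus totally ramified of degree e. *)
Lemma minPoly_zeta : minPoly K0 z = prime_power_cyclotomic L p a.
Proof.
have M0 : minPoly K0 z != 0 by rewrite monic_neq0 ?monic_minPoly.
have dv : minPoly K0 z %| prime_power_cyclotomic L p a.
  apply: minPoly_dvdp; first by rewrite rpred_sum // => i _; rewrite rpredX ?polyOverX.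
  by rewrite -[z]expr1 root_prime_power_cyclotomic ?coprime1n.
have PsiM := monic_prime_power_cyclotomic L a p_pr.
have Mle := dvdp_leq (monic_neq0 PsiM) dv.
apply/eqP; rewrite -eqp_monic ?monic_minPoly // -dvdp_size_eqp //.
rewrite eqn_leq Mle size_prime_power_cyclotomic // ltnNge; apply/negP => Me.
by have [] := horner_zeta_val (minPolyOver K0 z) M0 Me; rewrite minPolyxx eqxx.
Qed.

Context (zL : <<K0; z>>%VS = fullv).

Lemma adjoin_degree_zeta : adjoin_degree K0 z = e.
Proof.
apply: succn_inj; rewrite -size_minPoly minPoly_zeta.
by rewrite size_prime_power_cyclotomic.
Qed.

Lemma ramified_val x : x != 0 ->
  exists i y, [/\ (i < e)%N, y \is a Num.int & e%:R * v x = i%:R + e%:R * y].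
Proof.
move=> x0; have xE : (Fadjoin_poly K0 z x).[z] = x.
  by apply: Fadjoin_poly_eq; rewrite zL memvf.
rewrite -xE; apply: (proj2 (horner_zeta_val _ _ _)).
- exact: Fadjoin_polyOver.
- by apply: contra_neq x0 => P0; rewrite -xE P0 horner0.
- by rewrite -adjoin_degree_zeta size_Fadjoin_poly.
Qed.

Lemma ramified_val_int x : x != 0 -> e%:R * v x \is a Num.int.
Proof.
move=> /ramified_val[i [y [_ yi ->]]].
by rewrite rpredD ?rpredM ?natr_int.
Qed.

Lemma ramified_index x r : (0 < r)%N -> x != 0 -> r%:R * v x = 1 -> (r %| e)%N.
Proof.
move=> r0 x0 vr; have [K EK] := intrP (ramified_val_int x0).
have /(intr_inj (R := rat)) E : (e : int)%:~R = ((r : int) * K)%:~R :> rat.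
  rewrite intrM; transitivity (r%:R * (e%:R * v x)); last by rewrite EK.
  by rewrite mulrCA vr mulr1.
by suff : ((r : int) %| (e : int))%Z by []; rewrite E dvdz_mulr.
Qed.

(** The K0-automorphism z -> z^k, meaningful for k prime to p. With natural numbers as indices,
    composition becomes multiplication modulo N. *)
Definition sigma k : 'End(L) := kHomExtend K0 \1%VF z (z ^+ k).

Lemma sigma_kHom k : coprime k p -> kHom K0 {:L} (sigma k).
Proof.
move=> kp; rewrite -zL; apply: kHomExtendP (kHom1 _ _) _ => //.
by rewrite lfun1_poly minPoly_zeta root_prime_power_cyclotomic.
Qed.

Lemma sigmaM k : coprime k p -> {morph sigma k : x y / x * y}.
Proof. by move=> /sigma_kHom/kHomP_tmp[_ H] x y; rewrite H ?memvf. Qed.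

Lemma sigma_id k x : coprime k p -> x \in K0 -> sigma k x = x.
Proof. by move=> /sigma_kHom/kHomP_tmp[H _] /H. Qed.

Lemma sigma1 k : coprime k p -> sigma k 1 = 1.
Proof. by move=> kp; rewrite sigma_id ?mem1v. Qed.

Lemma sigmaX k x n : coprime k p -> sigma k (x ^+ n) = sigma k x ^+ n.
Proof.
move=> kp; elim: n => [|n IH]; first by rewrite !expr0 sigma1.
by rewrite !exprS sigmaM // IH.
Qed.

Lemma sigma_neq0 k x : coprime k p -> x != 0 -> sigma k x != 0.
Proof.
move=> kp x0; apply/eqP => s0; have := sigmaM kp x x^-1.
by rewrite divff // sigma1 // s0 mul0r => /eqP; rewrite oner_eq0.
Qed.

Lemma sigmaV k x : coprime k p -> sigma k x^-1 = (sigma k x)^-1.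
Proof.
move=> kp; have [->|x0] := eqVneq x 0; first by rewrite invr0 linear0 invr0.
apply: (mulfI (sigma_neq0 kp x0)); rewrite -sigmaM // !divff ?sigma1 //.
exact: sigma_neq0.
Qed.

Lemma sigma_horner k P : coprime k p -> P \is a polyOver K0 ->
  sigma k P.[z] = P.[z ^+ k].
Proof.
move=> kp PK; rewrite /sigma (kHomExtend_poly (kHom1 K0 K0)) ?lfun1_poly //.
by rewrite minPoly_zeta root_prime_power_cyclotomic.
Qed.

Lemma sigma_zeta k : coprime k p -> sigma k z = z ^+ k.
Proof. by move=> kp; have := sigma_horner kp (polyOverX K0); rewrite !hornerX. Qed.

Lemma sigma_zetaX k i : coprime k p -> sigma k (z ^+ i) = z ^+ (k * i).
Proof. by move=> kp; rewrite sigmaX // sigma_zeta // exprM. Qed.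

Lemma sigma_comp k l x : coprime k p -> coprime l p ->
  sigma k (sigma l x) = sigma (k * l) x.
Proof.
move=> kp lp; have : x \in <<K0; z>>%VS by rewrite zL memvf.
have klp : coprime (k * l) p by rewrite coprimeMl kp.
move=> /Fadjoin_polyP[P PK ->]; rewrite !sigma_horner // mulnC exprM.
rewrite !horner_coef linear_sum; apply: eq_bigr => i _ /=.
rewrite sigmaM // sigma_id ?(polyOverP PK) //; congr (_ * _).
by rewrite -!exprM sigma_zetaX // mulnCA mulnA.
Qed.

Lemma sigma_mod k l x : k = l %[mod N] -> sigma k x = sigma l x.
Proof. by move=> kl; rewrite /sigma -(prim_expr_mod z_prim k) kl (prim_expr_mod z_prim). Qed.

(** Write x = P(z) with deg P < e. Then P - x vanishes at the e conjugates z^k, so P is the constant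
    x. *)
Lemma sigma_fixed x : (forall k, coprime k p -> sigma k x = x) -> x \in K0.
Proof.
move=> fx; have xE : (Fadjoin_poly K0 z x).[z] = x.
  by apply: Fadjoin_poly_eq; rewrite zL memvf.
set P := Fadjoin_poly K0 z x in xE *.
have PK : P \is a polyOver K0 by exact: Fadjoin_polyOver.
have PC : P - x%:P = 0.
  apply/eqP; rewrite -size_poly_eq0 -leqn0 leqNgt size_poly_gt0; apply/negP => H.
  have allr : all (root (P - x%:P)) (coprime_roots p a z).
    apply/allP => y /mapP[k]; rewrite mem_filter => /andP[kp _] ->.
    by rewrite rootE !hornerE -sigma_horner // xE fx // subrr.
  have := max_poly_roots H allr (uniq_coprime_roots z_prim).
  rewrite size_coprime_roots ltnNge => /negP; apply.
  rewrite (leq_trans (size_polyD _ _)) // size_polyN geq_max size_polyC.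
  rewrite -{1}adjoin_degree_zeta size_Fadjoin_poly.
  by case: (x != 0) => //; exact: e_gt0.
have -> : x = P`_0 by move/eqP: PC; rewrite subr_eq0 => /eqP ->; rewrite coefC.
exact: (polyOverP PK).
Qed.

Context (M : L) (MK : M \in K0) (M0 : M != 0) (vM : v M = 1).

Let N1p : coprime N.-1 p.
Proof. by have := coprimePn N_gt0; rewrite coprime_pexpr. Qed.

(** The index N - 1 stands for -1 modulo N, so [s] inverts [z]. The element [M] will be pu. *)
Local Notation s := (sigma N.-1).

Lemma sigma_id1 x : sigma 1 x = x.
Proof.
have : x \in <<K0; z>>%VS by rewrite zL memvf.
by move=> /Fadjoin_polyP[P PK ->]; rewrite sigma_horner ?coprime1n // expr1.
Qed.

Lemma sigmaNN x : s (s x) = x.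
Proof.
rewrite sigma_comp // -[RHS]sigma_id1; apply: sigma_mod.
have -> : (N.-1 * N.-1 = N.-2 * N + 1)%N.
  have : (1 < N)%N by rewrite -(expn0 p) ltn_exp2l ?prime_gt1.
  by case: (N) => [|[|n]] //= _; lia.
by rewrite modnMDl.
Qed.

Lemma sigmaN_root1 t : t ^+ N = 1 -> s t = t^-1.
Proof.
move=> tN; have [i ->] := prim_rootP z_prim tN.
have zi : z ^+ i != 0.
  by rewrite expf_neq0 // (prim_root_eq0 z_prim) -lt0n.
apply: (mulfI zi); rewrite divff // sigma_zetaX // -exprD -mulSn prednK //.
by rewrite exprM (prim_expr_order z_prim) expr1n.
Qed.

Lemma sigmaC k l x : coprime k p -> coprime l p ->
  sigma k (sigma l x) = sigma l (sigma k x).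
Proof. by move=> kp lp; rewrite !sigma_comp // mulnC. Qed.

(** The factor z^k cancels against its image under [s]. The valuation of x s(x) is then 2/n. *)
Lemma norm_root1 x k n : x ^+ n = M * z ^+ k -> (x * s x) ^+ n = M ^+ 2.
Proof.
move=> xn; rewrite exprMn -sigmaX // xn sigmaM // (sigma_id _ MK) // sigmaN_root1.
  rewrite mulrACA divff ?mulr1 ?expr2 //.
  by rewrite expf_neq0 // (prim_root_eq0 z_prim) -lt0n.
by rewrite exprAC (prim_expr_order z_prim) expr1n.
Qed.

Lemma unramified_2val x n i : (0 < i < n)%N -> x \in K0 -> x != 0 -> n%:R * v x <> i%:R.
Proof.
move=> /andP[i0 ni] xK x0 E; have n0 : (0 < n)%N by lia.
have := @ltn_int_multiple_eq i 0 n (v x) ni n0 (K0_int xK x0).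
by rewrite E add0r => /(_ erefl); lia.
Qed.

(* The relative norm c = x * s x of a p-th root x satisfies c^p = M^2, and s fixes c
   but inverts the p-th roots of unity sigma k c / c: hence c is unramified. *)
Lemma no_pth_root x k : (2 < p)%N -> x ^+ p <> M * z ^+ k.
Proof.
move=> p2 xp; have cp := norm_root1 xp; set c := x * s x in cp.
have c0 : c != 0.
  by have := expf_neq0 2 M0; rewrite -cp expf_eq0 prime_gt0.
have sc : s c = c by rewrite /c sigmaM // sigmaNN mulrC.
have cK : c \in K0.
  apply: sigma_fixed => b bp; set t := sigma b c / c.
  have tc : sigma b c = t * c by rewrite /t divfK.
  have tp : t ^+ p = 1.
    by rewrite expr_div_n -sigmaX // cp sigmaX // (sigma_id _ MK) // divff // expf_neq0.
  have tN : t ^+ N = 1 by rewrite expnS exprM tp expr1n.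
  have t0 : t != 0 by rewrite mulf_neq0 ?invr_neq0 ?sigma_neq0.
  have : s (sigma b c) = sigma b (s c) by exact: sigmaC.
  rewrite sc tc sigmaM // sc sigmaN_root1 // => /(mulIf c0) tt.
  have t2 : t ^+ 2 = 1 by rewrite expr2 -{1}tt mulVf.
  have odp : odd p by case: (even_prime p_pr) => // p2'; rewrite p2' in p2.
  suff -> : t = 1 by rewrite mul1r.
  by move: tp; rewrite -(odd_double_half p) odp exprD expr1 -mul2n exprM t2 expr1n mulr1.
apply: (@unramified_2val c p 2) => //.
by rewrite -(pvalX vL) // cp (pvalX vL) // vM mulr1.
Qed.


Context (p2 : p = 2%N).

Let odd_coprime k : odd k = coprime k p.
Proof. by rewrite p2 coprimen2. Qed.

(* Here c = x * s x satisfies c^4 = M^2; for b = 1 mod 4, sigma b x = t x^b / M^((b-1)/4)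
   with t^4 = 1, and s inverts t, so that sigma b c = c^b / M^((b-1)/2) = c. *)
Lemma no_4th_root x k : (0 < a)%N -> x ^+ 4 <> M * z ^+ k.
Proof.
move=> a0 x4; have c4 := norm_root1 x4; set c := x * s x in c4.
have c0 : c != 0 by have := expf_neq0 2 M0; rewrite -c4 expf_eq0.
have [x0 sx0] : x != 0 /\ s x != 0.
  by move: c0; rewrite mulf_eq0 negb_or => /andP[].
have sc : s c = c by rewrite /c sigmaM // sigmaNN mulrC.
have d4N : (4 %| N)%N by rewrite p2 -[4%N]/(2 ^ 2)%N dvdn_exp2l.
have c1 l : sigma (4 * l + 1) c = c.
  set b := (4 * l + 1)%N; have bp : coprime b p by rewrite -odd_coprime oddD oddM.
  set t := sigma b x * M ^+ l / x ^+ b.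
  have bx : sigma b x = t * x ^+ b / M ^+ l.
    by rewrite /t divfK ?expf_neq0 // mulfK ?expf_neq0.
  have t4 : t ^+ 4 = 1.
    rewrite /t expr_div_n [(_ * _) ^+ 4]exprMn -sigmaX // x4 sigmaM //.
    rewrite (sigma_id _ MK) // sigma_zetaX // [(x ^+ b) ^+ 4]exprAC x4 [(M * _) ^+ b]exprMn -[(z ^+ k) ^+ b]exprM [(b * k)%N]mulnC.
    have -> : M ^+ b = M * (M ^+ l) ^+ 4 by rewrite -exprM -exprS mulnC /b addn1.
    have z0 : z != 0 by rewrite (prim_root_eq0 z_prim) -lt0n.
    have Ml0 : M * (M ^+ l) ^+ 4 != 0 by rewrite (mulf_neq0 M0) ?expf_neq0.
    by rewrite [X in X / _]mulrAC divff // (mulf_neq0 Ml0) ?expf_neq0.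
  have tN : t ^+ N = 1 by rewrite -(divnK d4N) mulnC exprM t4 expr1n.
  have t0 : t != 0 by rewrite !mulf_neq0 ?invr_neq0 ?expf_neq0 ?sigma_neq0.
  have st : s t = t^-1 by exact: sigmaN_root1.
  clearbody t.
  rewrite {1}/c sigmaM // sigmaC // bx !sigmaM // st sigmaV // !sigmaX //.
  rewrite (sigma_id _ MK) //.
  have -> : t * x ^+ b / M ^+ l * (t^-1 * s x ^+ b / M ^+ l)
      = (x * s x) ^+ b / (M ^+ 2) ^+ l.
    by rewrite exprMn -exprM mul2n -addnn exprD; field; rewrite t0 expf_neq0.
  by rewrite -/c -c4 -exprM /b exprD expr1 mulrC mulKf // expf_neq0.
have cK : c \in K0.
  apply: sigma_fixed => b; rewrite -odd_coprime => ob.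
  have [b1|b3] : (b %% 4 = 1 \/ b %% 4 = 3)%N by lia.
    by rewrite (divn_eq b 4) b1 mulnC c1.
  have bp : coprime b p by rewrite -odd_coprime.
  (* As [s] fixes c, b may be replaced by b(N - 1), which is 1 modulo 4 because 4 divides N. *)
  rewrite -{1}sc sigma_comp //.
  suff -> : (b * N.-1 = 4 * ((b * N.-1) %/ 4) + 1)%N by rewrite c1.
  have [q Nq] := dvdnP d4N; have q0 : (0 < q)%N by move: N_gt0; rewrite Nq; lia.
  have bE := divn_eq b 4; rewrite b3 in bE; rewrite Nq bE; nia.
apply: (@unramified_2val c 4 2) => //.
by rewrite -(pvalX vL) // c4 (pvalX vL) // vM mulr1.
Qed.

Lemma sigma_sqrt k y : coprime k p -> y ^+ 2 \in K0 ->
  sigma k y = y \/ sigma k y = - y.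
Proof.
move=> kp yK; have : sigma k y ^+ 2 == y ^+ 2 by rewrite -sigmaX // sigma_id.
by rewrite eqf_sqr => /orP[] /eqP; [left | right].
Qed.

Let sigma_even_sqrt k y : coprime k p -> y ^+ 2 \in K0 -> sigma (k * k) y = y.
Proof.
move=> kp yK; rewrite -sigma_comp //.
by case: (sigma_sqrt kp yK) => E; rewrite E ?linearN /= E ?opprK.
Qed.

(* A character of order 2 of (Z/N)^* factors through (Z/8)^*, since the integers congruent
   to 1 modulo 8 are squares in Z_2. *)
Lemma sigma_fixed_mod8 y : y ^+ 2 \in K0 -> sigma 3 y = y -> sigma 7 y = y -> y \in K0.
Proof.
move=> yK y3 y7; have c3 : coprime 3 p by rewrite -odd_coprime.
have c7 : coprime 7 p by rewrite -odd_coprime.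
(* 21 = 3 * 7 represents the class of 5 modulo 8. Thus 1, 3, 21, 7 cover the odd classes, each of
   which is its own inverse. *)
have [c21 y21] : coprime 21 p /\ sigma 21 y = y.
  by rewrite -odd_coprime -[21%N]/(3 * 7)%N -sigma_comp // y7 y3.
apply: sigma_fixed => b bp; have ob : odd b by rewrite odd_coprime.
have [b0 [b0p b0y bb]] : exists b0, [/\ coprime b0 p, sigma b0 y = y & (b * b0 %% 8 = 1)%N].
  have [b1|[b3|[b5|b7]]] : (b %% 8 = 1 \/ b %% 8 = 3 \/ b %% 8 = 5 \/ b %% 8 = 7)%N.
    have : odd (b %% 8) by rewrite odd_mod.
    by have := ltn_pmod b (isT : 0 < 8)%N; case: (b %% 8)%N => [|[|[|[|[|[|[|[|]]]]]]]]; auto.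
  - by exists 1%N; rewrite coprime1n sigma_id1 muln1.
  - by exists 3; rewrite -modnMml b3.
  - by exists 21; rewrite -modnMml b5.
  - by exists 7; rewrite -modnMml b7.
suff : sigma (b * b0) y = y by rewrite -sigma_comp // b0y.
(* b * b0 is 1 modulo 8, hence a square in Z_2; truncating the root at level a + 1 makes it a square
   modulo N. *)
have p_pr2 : prime 2 by [].
have [|r rE] := @zp2_sqrt p_pr2 (b * b0)%:R ((b * b0) %/ 8)%:R.
  by rewrite {1}(divn_eq (b * b0) 8) bb natrD natrM addrC mulrC.
have rN : (b * b0 = r a.+1 * r a.+1 %[mod N])%N.
  have := congr1 (fun q : padic_int p_pr2 => q a.+1) rE.
  by rewrite res_expr res_nat p2 -mulnn => ->.
rewrite (sigma_mod _ rN); apply: sigma_even_sqrt yK.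
have N_even : odd N = false by rewrite p2 oddX.
have : odd (b * b0 %% N) by rewrite odd_mod // oddM !odd_coprime bp b0p.
by rewrite rN odd_mod // oddM -odd_coprime => /andP[].
Qed.

(** Kummer theory of exponent 2: a square root in L of an element of K0 enters K0 after
    multiplication by 1 or i if N = 4, and by one of 1, i, sqrt 2, i sqrt 2 if 8 divides N.
    Valuations exclude the multipliers that would give M or -M a root in K0. *)
Lemma sqrt_unramified x k c : (0 < a)%N -> M = 2%:R * c -> x ^+ 2 = M * z ^+ k ->
  exists2 y, y \in K0 & y ^+ 2 = c \/ y ^+ 2 = - c.
Proof.
move=> a0 Mc x2; have z0 : z != 0 by rewrite (prim_root_eq0 z_prim) -lt0n.
have z_half : z ^+ (2 ^ a) = - 1.
  have : (z ^+ (2 ^ a)) ^+ 2 == 1 ^+ 2.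
    by rewrite -exprM -expnSr -p2 (prim_expr_order z_prim) expr1n.
  rewrite eqf_sqr => /orP[|/eqP //]; rewrite -(prim_order_dvd z_prim) p2.
  by rewrite dvdn_Pexp2l // ltnn.
have two0 : 2%:R != 0 :> L by rewrite -p2.
have x0 : x != 0.
  by have := mulf_neq0 M0 (expf_neq0 k z0); rewrite -x2 expf_eq0.
have c3 : coprime 3 p by rewrite -odd_coprime.
have c7 : coprime 7 p by rewrite -odd_coprime.
have half y : y \in K0 -> y ^+ 2 = M \/ y ^+ 2 = - M -> False.
  move=> yK yM; have y0 : y != 0.
    apply/eqP => y0; have := M0; rewrite y0 expr0n in yM.
    by case: yM => [<-|/esym/eqP]; rewrite ?eqxx // oppr_eq0 => ->.
  apply: (@unramified_2val y 2 1) => //; rewrite -(pvalX vL) //.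
  by case: yM => ->; rewrite ?(pvalN vL).
have [|a1] : (a = 1 \/ 1 < a)%N by lia.
  move=> a1; have N4 : N = 4%N by rewrite p2 a1.
  have fixed4 y : sigma 3 y = y -> y \in K0.
    move=> y3; apply: sigma_fixed => b; rewrite -odd_coprime => ob.
    have [b1|b3] : (b %% 4 = 1 \/ b %% 4 = 3)%N.
      have : odd (b %% 4) by rewrite odd_mod.
      by have := ltn_pmod b (isT : 0 < 4)%N; case: (b %% 4)%N => [|[|[|[|]]]]; auto.
    + by rewrite (@sigma_mod _ 1) ?sigma_id1 // N4 b1.
    + by rewrite (@sigma_mod _ 3) // N4 b3.
  have zz : z ^+ 2 = - 1 by rewrite -z_half a1.
  have sqrt4 y : y ^+ 2 \in K0 -> y \in K0 \/ z * y \in K0.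
    move=> yK; have [y3|y3] := sigma_sqrt c3 yK; [left|right]; apply: fixed4 => //.
    by rewrite sigmaM // y3 sigma_zeta // exprS zz mulrN1 mulrNN.
  have sqrtz y : (z * y) ^+ 2 = - y ^+ 2 by rewrite exprMn zz mulN1r.
  (* Here z = i. For even k, x / z^(k/2) is a root of M, and it or its product with i would lie in
     K0 with valuation 1/2. *)
  have [ok|ek] := boolP (odd k); last first.
    pose y := x / z ^+ k./2; have yM : y ^+ 2 = M.
      by rewrite /y expr_div_n x2 -exprM muln2 even_halfK // mulfK // expf_neq0.
    exfalso; have [|yK|yK] := sqrt4 y; first by rewrite yM.
    + by apply: half yK _; left.
    + by apply: half yK _; right; rewrite sqrtz yM.
  have z1 : 1 + z != 0.
    apply/eqP => /eqP; rewrite addr_eq0 => /eqP zN.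
    move: zz; rewrite -[z]opprK -zN sqrrN expr1n => /eqP.
    by rewrite -subr_eq0 opprK -[1 + 1]/(2%:R) (negPf two0).
  have zk : z ^+ k = z \/ z ^+ k = - z.
    rewrite -(odd_double_half k) ok -mul2n exprD expr1 exprM zz -signr_odd.
    by case: (odd _); rewrite ?expr0 ?expr1 ?mulr1 ?mulrN1; [right|left].
  (* (1 + z)^2 = 2z removes the factor 2 of M, and z^k / z is 1 or -1 for odd k. *)
  pose y := x / (1 + z); have yc : y ^+ 2 = c \/ y ^+ 2 = - c.
    have -> : y ^+ 2 = c * (z ^+ k / z).
      have -> : y ^+ 2 = 2%:R * c * z ^+ k / (1 + z) ^+ 2.
        by rewrite /y expr_div_n x2 Mc.
      have -> : (1 + z) ^+ 2 = 2%:R * z.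
        by transitivity (1 + z ^+ 2 + 2%:R * z); [ring | rewrite zz subrr add0r].
      by field; rewrite two0 z0.
    by case: zk => ->; rewrite ?mulNr divff // ?mulrN mulr1; [left|right].
  have cK : c \in K0.
    by rewrite -(mulKf two0 c) -Mc rpredM // rpredV rpredMn // rpred1.
  have [|yK|yK] := sqrt4 y.
  + by case: yc => ->; rewrite ?rpredN.
  + by exists y.
  + by exists (z * y) => //; rewrite sqrtz; case: yc => ->; rewrite ?opprK; [right|left].
have [b aE] : exists b, a = b.+2 by exists a.-2; lia.
(* Now 8 divides N, and [h] is a primitive 8th root of unity. *)
pose h := z ^+ (2 ^ b); have h4 : h ^+ 4 = - 1.
  by rewrite /h -exprM -[4%N]/(2 ^ 2)%N -expnD addn2 -aE.
have hX n : h ^+ (4 + n) = - h ^+ n by rewrite exprD h4 mulN1r.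
have sh l : coprime l p -> sigma l h = h ^+ l.
  by move=> lp; rewrite /h sigma_zetaX // mulnC exprM.
clearbody h.
have [ok|ek] := boolP (odd k).
  (* This automorphism maps z to -z, so for odd k it maps x^2 to -x^2 and x to h^2 x up to sign. It
     fixes h^2, so its square maps x to -x, although (2^a + 1)^2 = 1 modulo N. *)
  exfalso; have bp : coprime (2 ^ a + 1) p by rewrite -odd_coprime oddD oddX aE.
  have sx : sigma (2 ^ a + 1) x ^+ 2 = - x ^+ 2.
    rewrite -sigmaX // x2 sigmaM // (sigma_id _ MK) // sigma_zetaX // mulnDl mul1n.
    rewrite exprD exprM z_half -(odd_double_half k) ok -mul2n [(-1) ^+ _]exprD expr1.
    by rewrite [(-1) ^+ (2 * _)]exprM sqrrN !expr1n mulr1 mulN1r mulrN.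
  have h22 : (h ^+ 2) ^+ 2 = - 1 by rewrite -exprM.
  have sh2 : sigma (2 ^ a + 1) (h ^+ 2) = h ^+ 2.
    rewrite sigmaX // sh // -!exprM mulnDl mul1n exprD.
    have -> : (2 ^ a * 2 = 4 * 2 ^ b.+1)%N by rewrite aE !expnS; lia.
    by rewrite exprM h4 expnS exprM sqrrN !expr1n mul1r.
  have ssx : sigma (2 ^ a + 1) (sigma (2 ^ a + 1) x) = x.
    rewrite sigma_comp // -[RHS]sigma_id1; apply: sigma_mod.
    have -> : ((2 ^ a + 1) * (2 ^ a + 1) = (2 ^ b.+1 + 1) * N + 1)%N.
      by rewrite p2 aE !expnS; nia.
    by rewrite modnMDl.
  have : (sigma (2 ^ a + 1) x) ^+ 2 == (h ^+ 2 * x) ^+ 2.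
    by rewrite sx [X in _ == X]exprMn h22 mulN1r.
  have xx : h ^+ 2 * (h ^+ 2 * x) <> x.
    rewrite mulrA -expr2 h22 mulN1r => /eqP; rewrite -subr_eq0 -opprD oppr_eq0.
    by rewrite -mulr2n -mulr_natl mulf_eq0 (negPf two0) (negPf x0).
  rewrite eqf_sqr => /orP[] /eqP E; apply: xx; rewrite -[RHS]ssx E.
    by rewrite sigmaM // sh2 E.
  by rewrite linearN /= sigmaM // sh2 E mulrN opprK.
pose y := x / z ^+ k./2; have yM : y ^+ 2 = M.
  by rewrite /y expr_div_n x2 -exprM muln2 even_halfK // mulfK // expf_neq0.
(* r = h + 1/h is a square root of 2: [sigma 7] fixes it and [sigma 3] negates it, while both negate
   i = h^2. *)
pose r := h + h ^+ 7; have r2 : r ^+ 2 = 2%:R.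
  have -> : r = h - h ^+ 3 by rewrite /r -[7%N]/(4 + 3)%N hX.
  have -> : 2%:R = - (h ^+ 4 *+ 2) by rewrite h4 mulNrn opprK.
  have : (h ^+ 4 + 1) * h ^+ 2 = 0 by rewrite h4 addNr mul0r.
  by move=> H; rewrite -[RHS]addr0 -H; ring.
have r3 : sigma 3 r = - r.
  rewrite /r linearD /= sigmaX // sh // -exprM -[(3 * 7)%N]/(4 + (4 + (4 + (4 + (4 + 1)))))%N.
  by rewrite !hX expr1 !opprK opprB addrC.
have r7 : sigma 7 r = r.
  rewrite /r linearD /= sigmaX // sh // -exprM.
  rewrite -[(7 * 7)%N]/(4 + (4 + (4 + (4 + (4 + (4 + (4 + (4 + (4 + (4 + (4 + (4 + 1))))))))))))%N.
  by rewrite !hX expr1 !opprK addrC.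
pose i := h ^+ 2; have i3 : sigma 3 i = - i.
  by rewrite /i sigmaX // sh // -exprM -[(3 * 2)%N]/(4 + 2)%N hX.
have i7 : sigma 7 i = - i.
  rewrite /i sigmaX // sh // -exprM -[(7 * 2)%N]/(4 + (4 + (4 + 2)))%N.
  by rewrite !hX !opprK.
have i2 : i ^+ 2 = - 1 by rewrite /i -exprM.
clearbody i r y.
have MK' : - M \in K0 by rewrite rpredN.
have K2 : 2%:R \in K0 by rewrite rpredMn ?rpred1.
have final y' : y' \in K0 -> y' ^+ 2 = 2%:R * M \/ y' ^+ 2 = - (2%:R * M) ->
    exists2 y, y \in K0 & y ^+ 2 = c \/ y ^+ 2 = - c.
  move=> yK yc; exists (y' / 2%:R); first by rewrite rpred_div.
  have E : 2%:R * M / 2%:R ^+ 2 = c.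
    by rewrite Mc mulrA -expr2 mulrC mulKf // expf_neq0.
  by rewrite expr_div_n; case: yc => ->; [left | right; rewrite mulNr]; rewrite E.
have yK2 : y ^+ 2 \in K0 by rewrite yM.
(* In the four cases the signs of y are compensated by 1, ir, r, i. With 1 or i the square is M or
   -M, of odd valuation; with r or ir it is 2M = 4c up to sign, and [final] halves the root. *)
have [y3|y3] := sigma_sqrt c3 yK2; have [y7|y7] := sigma_sqrt c7 yK2.
- by exfalso; apply: half (sigma_fixed_mod8 yK2 y3 y7) _; left.
- have E : (i * r * y) ^+ 2 = - (2%:R * M) by rewrite !exprMn i2 r2 yM mulN1r mulNr.
  apply: (final (i * r * y)); last by right.
  apply: sigma_fixed_mod8; first by rewrite E rpredN rpredM.
    by rewrite !sigmaM // i3 r3 y3 mulrNN.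
  by rewrite !sigmaM // i7 r7 y7 mulNr mulrNN.
- have E : (r * y) ^+ 2 = 2%:R * M by rewrite !exprMn r2 yM.
  apply: (final (r * y)); last by left.
  apply: sigma_fixed_mod8; first by rewrite E rpredM.
    by rewrite !sigmaM // r3 y3 mulrNN.
  by rewrite !sigmaM // r7 y7.
- have E : (i * y) ^+ 2 = - M by rewrite !exprMn i2 yM mulN1r.
  exfalso; apply: (half (i * y)); last by right.
  by apply: sigma_fixed_mod8; rewrite ?E // !sigmaM ?i3 ?i7 ?y3 ?y7 ?mulrNN.
Qed.

End Ramified.

(** * Dyadic square roots *)

Lemma zp2_unit_mod8 (p_pr : prime 2) (u : padic_int p_pr) : u \is a GRing.unit ->
  exists r c, r \in [:: 1; 3; 5; 7]%N /\ u = r%:R + 8%:R * c.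
Proof.
move=> uu; have /zp_congP[c uc] : u 3 = ((u 3)%:R : padic_int p_pr) 3 by rewrite res_nat res_mod.
exists (u 3), c; split; last by rewrite {1}uc -natrX.
have : (u 3 < 8)%N by rewrite -(res_mod u 3) ltn_mod.
have : odd (u 3).
  move: uu; rewrite zp_unitE -(res_mod u 1) -(res_le u (isT : 1 <= 3)%N) modn2.
  by case: odd.
by move: (u 3) => r; do 8! [case: r => [|r] //].
Qed.

Section Dyadic.
Context (p_pr : prime 2).
Local Notation Zp := (padic_int p_pr).
Context (F : fieldType) (L : fieldExtType F) (j : {rmorphism Zp -> L}) (v : L -> rat).
Context (Lv : zp_field_ext j v).
Context (u : Zp) (u_unit : u \is a GRing.unit).

Let vL : division_valuation v := zpf_val Lv.
Let two0 : 2%:R != 0 :> L := zpf_p0 Lv.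

Lemma zpf_unit0 c : c \is a GRing.unit -> j c != 0.
Proof. by move=> /(rmorph_unit j); rewrite unitfE. Qed.

Lemma zp2_odd_unit r (c : Zp) : odd r -> r%:R + 2%:R * c \is a GRing.unit.
Proof.
move=> od; apply: (@zp_unit1 _ _ _ (r./2%:R + c)).
by rewrite -{1}(odd_double_half r) od /= add1n -mul2n -natr1 natrM; ring.
Qed.

Let three0 : 3%:R != 0 :> L.
Proof.
rewrite -(rmorph_nat j); apply: zpf_unit0.
by rewrite -[3%:R]addr0 -(mulr0 2%:R) zp2_odd_unit.
Qed.

(** t = 2q + 1 is a square root of -3. For u = 1, 3, 5, 7 modulo 8, respectively u, 3u, -3u, -u is 1
    modulo 8, hence a square in Z_2; in the middle cases its root is divided by t. *)
Lemma cube_root_sqrt (q : L) : q ^+ 2 + q + 1 = 0 ->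
  exists y, y ^+ 2 = j u \/ y ^+ 2 = - j u.
Proof.
move=> q3; have [r [c [rr uE]]] := zp2_unit_mod8 u_unit.
pose t := 2%:R * q + 1; have t2 : t ^+ 2 = - 3%:R.
  transitivity (4%:R * (q ^+ 2 + q + 1) - 3%:R); first by rewrite /t; ring.
  by rewrite q3 mulr0 add0r.
have t0 : t != 0 by have := three0; rewrite -oppr_eq0 -t2 expf_eq0.
have ts (s : Zp) : (j s / t) ^+ 2 = - (j (s ^+ 2) / 3%:R).
  by rewrite expr_div_n t2 rmorphXn invrN mulrN.
have j3 (x : Zp) : j (3%:R * x) / 3%:R = j x.
  by rewrite rmorphM rmorph_nat mulrC mulKf.
move: rr; rewrite !inE => /or4P[] /eqP rE; rewrite {}rE in uE.
- have [s sE] := zp2_sqrt uE.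
  by exists (j s); left; rewrite -rmorphXn sE.
- have [|s sE] := @zp2_sqrt p_pr (3%:R * u) (1 + 3%:R * c); first by rewrite uE; ring.
  by exists (j s / t); right; rewrite ts sE j3.
- have [|s sE] := @zp2_sqrt p_pr (- (3%:R * u)) (- 2%:R - 3%:R * c); first by rewrite uE; ring.
  by exists (j s / t); left; rewrite ts sE rmorphN mulNr opprK j3.
- have [|s sE] := @zp2_sqrt p_pr (- u) (- 1 - c); first by rewrite uE; ring.
  by exists (j s); right; rewrite -rmorphXn sE rmorphN.
Qed.

Context (m : nat) (w : L) (m_gt0 : (0 < m)%N) (m_odd : coprime 2 m) (wm : w ^+ m = 1).

(** If u = 3 modulo 4, then (y + 1)^2 = 2y + (u + 1) has valuation 1, and v(y + 1) = 1/2 is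
    impossible in K0. If u = 5 modulo 8, then -3u = s^2 in Z_2, so sy/u is a square root of -3 and
    yields a cube root of unity; it is obtained in Z_2[w], for later use of the order O. *)
Lemma unramified_sqrt_mod8 y : y \in <<1; w>>%VS -> y ^+ 2 = j u ->
  eqmod_zp 8 u 1 \/ exists P, 3.-primitive_root (zp_eval j w P).
Proof.
move=> yK yu; have [r [c [rr uE]]] := zp2_unit_mod8 u_unit.
have [K KE] : exists K : {subfield L}, K = <<1; w>>%AS by exists <<1; w>>%AS.
have yK' : y \in K by rewrite KE.
have K_int x : x \in K -> x != 0 -> v x \is a Num.int.
  by rewrite KE; exact: (unramified_val_int Lv m_gt0 m_odd wm).
have j_in x : j x \in K by apply: (subvP (sub1v K)); exact: (zpf_base Lv).
have y0 : y != 0 by have := zpf_unit0 u_unit; rewrite -yu expf_eq0.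
have vy : v y = 0.
  by have [_] := zpf_unit Lv u_unit; rewrite -yu (pvalX vL) //; lra.
have no3 d : u + 1 = 4%:R * d -> False.
  move=> ud; have y2 : 2%:R * y != 0 by rewrite mulf_neq0.
  have v2 : v 2%:R = 1 := zpf_vp Lv.
  have yE : (y + 1) ^+ 2 = 2%:R * y + 4%:R * j d.
    transitivity (y ^+ 2 + 1 + 2%:R * y); first by ring.
    have ju1 : j u + 1 = 4%:R * j d.
      by rewrite -(rmorph_nat j 4) -rmorphM -ud rmorphD rmorph1.
    by rewrite yu ju1 addrC.
  have [y10 vy1] : (y + 1) ^+ 2 != 0 /\ v ((y + 1) ^+ 2) = 1.
    rewrite yE; have v2y : v (2%:R * y) = 1 by rewrite (pvalM vL) // v2 vy addr0.
    have [->|d0] := eqVneq (j d) 0; first by rewrite mulr0 addr0.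
    have f4 : 4%:R = 2%:R * 2%:R :> L by rewrite -natrM.
    have f0 : 4%:R != 0 :> L by rewrite f4 mulf_neq0 ?two0.
    rewrite -v2y; apply: (pvalD_lt vL) => //; first by rewrite mulf_neq0.
    rewrite v2y (pvalM vL) // f4 (pvalM vL) ?two0 // v2.
    by have := zpf_ge0 Lv d0; lra.
  have y1 : y + 1 != 0 by move: y10; rewrite expf_eq0.
  have := @ltn_int_multiple_eq 1 0 2 (v (y + 1)) isT isT.
  rewrite -(pvalX vL) // vy1 add0r => H; suff : 1%N = 0%N by [].
  by apply: H; rewrite // K_int // rpredD ?rpred1.
move: rr; rewrite !inE => /or4P[] /eqP rE; rewrite {}rE in uE.
- by left; exists c.
- by case: (no3 (1 + 2%:R * c)); rewrite uE; ring.
- have [|s sE] := @zp2_sqrt p_pr (- (3%:R * u)) (- 2%:R - 3%:R * c); first by rewrite uE; ring.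
  have ju0 := zpf_unit0 u_unit.
  pose t := j s * y / j u; have t2 : t ^+ 2 = - 3%:R.
    rewrite /t expr_div_n exprMn yu -rmorphXn sE rmorphN rmorphM rmorph_nat.
    by field.
  pose q := (t - 1) / 2%:R; have q3 : q ^+ 2 + q + 1 = 0.
    have qt : 2%:R * q + 1 = t by rewrite /q mulrC divfK // subrK.
    apply: (mulfI two0); apply: (mulfI two0); rewrite !mulr0.
    transitivity ((2%:R * q + 1) ^+ 2 + 3%:R); first by ring.
    by rewrite qt t2 addNr.
  have q1 : q ^+ 3 = 1.
    apply/eqP; rewrite -subr_eq0; apply/eqP.
    by transitivity ((q - 1) * (q ^+ 2 + q + 1)); [ring | rewrite q3 mulr0].
  have qK : q \in <<1; w>>%VS.
    suff : q \in K by rewrite KE.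
    by rewrite rpred_div ?rpredB ?rpred1 ?rpredMn ?rpred1 // rpred_div ?rpredM.
  have [P qP] := unramified_root1 Lv m_gt0 m_odd wm qK (isT : 0 < 3)%N q1.
  right; exists P; rewrite -qP; have [d dq d3] := prim_order_exists (isT : 0 < 3)%N q1.
  have [_ /(_ d d3)] := primeP (isT : prime 3).
  case/orP => /eqP dE; last by rewrite -dE.
  have := prim_expr_order dq; rewrite dE expr1 => q1E; move: q3.
  rewrite q1E expr1n => E; case/eqP: three0; rewrite -E; ring.
- by case: (no3 (2%:R + 2%:R * c)); rewrite uE; ring.
Qed.

End Dyadic.

(** (1 + i)^2 = 2i, and a sign of c is absorbed by -i = i^3. *)
Lemma dyadic_extension (R : comNzRingType) (i y c : R) : i ^+ 2 = - 1 ->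
  y ^+ 2 = c \/ y ^+ 2 = - c ->
  ((1 + i) * y) ^+ 2 = 2%:R * c * i \/ ((1 + i) * y) ^+ 2 = 2%:R * c * i ^+ 3.
Proof.
move=> i2 yc; have E : (1 + i) ^+ 2 = 2%:R * i.
  by transitivity (1 + i ^+ 2 + 2%:R * i); [ring | rewrite i2 subrr add0r].
by rewrite exprMn E; case: yc => ->; [left | right; rewrite exprS i2]; ring.
Qed.

(** * The root of pu for odd p *)

Section CompleteSubring.
Context (p : nat) (p_pr : prime p).
Local Notation Zp := (padic_int p_pr).
Context (F : fieldType) (L : fieldExtType F) (j : {rmorphism Zp -> L}) (v : L -> rat).
Context (Lv : zp_field_ext j v).
Context (m : nat) (w : L) (m_gt0 : (0 < m)%N) (wm : w ^+ m = 1).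
Local Notation ev := (zp_eval j w).

Let vL : division_valuation v := zpf_val Lv.
Let p0 : p%:R != 0 :> L := zpf_p0 Lv.

(** Reduction modulo X^m - 1 bounds the degree, so that limits in Z_p[w] can be taken coefficient by
    coefficient. *)
Lemma zp_eval_small (P : {poly Zp}) : exists Q : {poly Zp}, (size Q <= m)%N /\ ev P = ev Q.
Proof.
have Xm : ('X^m - 1 : {poly Zp}) \is monic by exact: (monicXnsubC 1 m_gt0).
exists (Pdiv.Ring.rmodp P ('X^m - 1)); split.
  have := Pdiv.Ring.ltn_rmodpN0 P (monic_neq0 Xm).
  by rewrite [X in (_ < X)%N -> _](size_XnsubC 1 m_gt0) ltnS.
rewrite {1}(Pdiv.RingMonic.rdivp_eq Xm P) zp_evalD zp_evalM.
suff -> : ev ('X^m - 1) = 0 by rewrite mulr0 add0r.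
by rewrite zp_evalB zp_evalXn zp_eval1 zp_evalX wm subrr.
Qed.

Lemma zp_eval_lim (f : nat -> {poly Zp}) :
  (forall N, exists d, ev (f N.+1) = ev (f N) + p%:R ^+ N * ev d) ->
  exists Y, forall N, exists d, ev Y = ev (f N + p%:R ^+ N * d).
Proof.
move=> fP; have /choice[d dP] : forall N, exists d : {poly Zp},
    (size d <= m)%N /\ ev (f N.+1) = ev (f N) + p%:R ^+ N * ev d.
  by move=> N; have [d ->] := fP N; have [Q [sQ ->]] := zp_eval_small d; exists Q.
pose g N := \sum_(k < N) p%:R ^+ k * d k.
have gE N : ev (f N) = ev (f 0%N + g N).
  elim: N => [|N IH]; first by rewrite /g big_ord0 addr0.
  rewrite (dP N).2 IH /g big_ord_recr /= !zp_evalD zp_evalM zp_evalXn zp_eval_nat.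
  by rewrite addrA.
have gm N k : (m <= k)%N -> (g N)`_k = 0.
  move=> mk; rewrite /g coef_sum big1 // => i _.
  rewrite -natrX mulr_natl coefMn nth_default ?mul0rn //.
  exact: leq_trans (dP i).1 mk.
have /choice[C CP] : forall k, exists c : Zp, forall N, exists e, c = (g N)`_k + p%:R ^+ N * e.
  move=> k; apply: zp_lim => N; exists (d N)`_k.
  by rewrite /g big_ord_recr /= coefD -!natrX !mulr_natl coefMn.
exists (f 0%N + \poly_(k < m) C k) => N.
have /choice[e eP] := fun k => CP k N.
exists (\poly_(k < m) e k); rewrite [RHS]zp_evalD gE -zp_evalD -addrA.
congr (ev (_ + _)); apply/polyP => k; rewrite coefD -natrX mulr_natl coefMn !coef_poly.
case: ltnP => [km|mk]; last by rewrite gm // mul0rn addr0.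
by rewrite eP -natrX mulr_natl.
Qed.

Lemma zp_eval_separated x : (forall N, exists P, x = p%:R ^+ N * ev P) -> x = 0.
Proof.
move=> xP; apply/eqP/negPn/negP => x0.
have vw : v w = 0 by exact: (pval_root1 vL m_gt0 wm).
have := archi_boundP (normr_ge0 (v x)); set N := Num.bound _ => xN.
have [P xE] := xP N; have P0 : ev P != 0.
  by apply: contra_neq x0 => P0; rewrite xE P0 mulr0.
have := zp_eval_ge0 Lv vw P0; have := ler_norm (v x).
rewrite {1}xE (pvalM vL) ?expf_neq0 // (pvalX vL) // (zpf_vp Lv).
by move: xN; lra.
Qed.

(* With S = lim s^(1 + p + ... + p^(N-1)), one has S^(p-1) s = lim s^(p^N) = 1. *)
Lemma one_unit_root s b : ev s ^+ p = 1 + p%:R * ev b ->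
  exists S, S ^+ p.-1 * ev s = 1.
Proof.
move=> sb; pose E := fix E N := if N is N'.+1 then (E N' + p ^ N')%N else 0%N.
have EE N : ((E N * p.-1).+1 = p ^ N)%N.
  elim: N => [|N IH] //=; rewrite mulnDl -addSn IH.
  by rewrite -mulnS prednK ?prime_gt0 // expnSr.
have sN N : exists d, ev s ^+ (p ^ N) = 1 + p%:R ^+ N * ev d.
  case: N => [|N]; first by exists (s - 1); rewrite expn0 expr1 mul1r zp_evalB zp_eval1 addrC subrK.
  elim: N => [|N [d IH]]; first by exists b; rewrite expn1 expr1.
  have [r rE] := expr_prime_cong p_pr (erefl (1 + p%:R ^+ N.+1 * d)).
  exists r; rewrite expnSr exprM IH.
  have -> : 1 + p%:R ^+ N.+1 * ev d = ev (1 + p%:R ^+ N.+1 * d).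
    by rewrite zp_evalD zp_eval1 zp_evalM zp_evalXn zp_eval_nat.
  by rewrite -zp_evalXn rE expr1n zp_evalD zp_eval1 zp_evalM zp_evalXn zp_eval_nat.
have [N|Y YP] := @zp_eval_lim (fun N => s ^+ E N).
  have [d dE] := sN N; exists (s ^+ E N * d).
  by rewrite /= exprD !zp_evalM !zp_evalXn dE; ring.
exists (ev Y); apply/eqP; rewrite -subr_eq0; apply/eqP/zp_eval_separated => N.
have [d ->] := YP N; have [r rE] := exprD_cong (s ^+ E N) (p%:R ^+ N) d p.-1.
have [e eE] := sN N; exists (e + r * s).
rewrite -zp_evalXn rE -exprM !zp_evalD !zp_evalM !zp_evalXn zp_eval_nat.
rewrite mulrDl -exprSr EE eE; ring.
Qed.

End CompleteSubring.

Section OddPrime.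
Context (p : nat) (p_pr : prime p) (p_odd : (2 < p)%N).
Local Notation Zp := (padic_int p_pr).
Context (F : fieldType) (L : fieldExtType F) (j : {rmorphism Zp -> L}) (v : L -> rat).
Context (Lv : zp_field_ext j v).
Context (z : L) (z_prim : p.-primitive_root z).
Local Notation ev := (zp_eval j z).

(** Factor 1 - z out of each 1 - z^i. At z = 1 the cofactor becomes (p-1)!, which is -1 modulo p by
    Wilson. *)
Lemma prod_geometric_roots :
  p%:R = (1 - z) ^+ p.-1 * ev (\prod_(i < p.-1) \sum_(k < i.+1) 'X^k).
Proof.
have z_prim1 : (p ^ 1).-primitive_root z by rewrite expn1.
have p_gt0 := prime_gt0 p_pr.
rewrite (prod_coprime_roots p_pr z_prim1) /coprime_roots big_map big_filter expn1.
have -> : iota 0 p = index_iota 0 p by rewrite /index_iota subn0.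
rewrite big_ltn_cond // /coprime gcd0n (gtn_eqF (prime_gt1 p_pr)) big_add1 big_mkord.
rewrite rmorph_prod -[p.-1 in X in _ = X * _]card_ord -prodr_const -big_split.
apply: eq_big => [i|i _ /=].
  rewrite gcdnC -/(coprime _ _) prime_coprime // gtnNdvd //.
  by have := ltn_ord i; lia.
rewrite -[LHS]opprB subrX1 -mulNr opprB rmorph_sum /=; congr (_ * _).
apply: eq_bigr => k _; rewrite -{1}(zp_evalX j z). exact/esym/zp_evalXn.
Qed.

(** With p = pi^(p-1) T(z), the factor t makes s = utT(z) a 1-unit. Then S^(p-1) s = 1 has a
    solution S, and x = pi / S. *)
Lemma exists_root_pu (u t : Zp) c : u * t = - 1 + p%:R * c ->
  exists x, x ^+ p.-1 = p%:R * j u * j t.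
Proof.
move=> ut; pose T : {poly Zp} := \prod_(i < p.-1) \sum_(k < i.+1) 'X^k.
have T1 : T.[1] = (p.-1)`!%:R.
  rewrite horner_prod fact_prod natr_prod big_add1 /= big_mkord.
  apply: eq_bigr => i _; rewrite horner_sum (eq_bigr (fun=> 1)) ?sumr_const ?card_ord //.
  by move=> k _; rewrite hornerXn expr1n.
have [d dE] : exists d : Zp, (p.-1)`!%:R = - 1 + p%:R * d.
  have := Wilson (prime_gt1 p_pr); rewrite p_pr => /esym/dvdnP[k kE].
  exists k%:R; rewrite -natrM mulnC -kE -natr1; ring.
have [q qE] : exists q, T = T.[1]%:P + (1 - 'X) * q.
  have /factor_theorem[q qE] : root (T - T.[1]%:P) 1 by rewrite rootE !hornerE subrr.
  by exists (- q); rewrite -[LHS](subrK T.[1]%:P) qE; ring.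
have pT := prod_geometric_roots; rewrite -/T in pT.
pose pi := 1 - z; have piE : ev (1 - 'X) = pi by rewrite zp_evalB zp_eval1 zp_evalX.
(* As z^p = 1, the expansion of (1 - z)^p leaves a multiple of p; a p-th power therefore turns 1
   modulo pi into 1 modulo p. *)
have [r rE] : exists r, pi ^+ p = p%:R * ev r.
  have [r rE] := exprD_prime (1 : {poly Zp}) (- 'X) p_pr.
  exists (1 * - 'X * r); rewrite -piE -zp_evalXn rE expr1n exprNn.
  have -> : (-1) ^+ p = -1 :> {poly Zp}.
    rewrite -signr_odd; case: (even_prime p_pr) => [pE|->]; last by rewrite expr1.
    by have := p_odd; rewrite [X in (_ < X)%N]pE.
  rewrite mulN1r zp_evalD zp_evalB zp_eval1 zp_evalXn zp_evalM zp_eval_nat zp_evalX.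
  by rewrite (prim_expr_order z_prim) subrr add0r.
pose s := u%:P * t%:P * T.
have [b bE] : exists b, ev s = 1 + pi * ev b.
  have [h hE] : exists h : Zp, u * t * T.[1] = 1 + p%:R * h.
    by exists (- c - d + p%:R * c * d); rewrite ut T1 dE; ring.
  exists ((1 - 'X) ^+ p.-2 * T * h%:P + u%:P * t%:P * q).
  have -> : s = 1 + p%:R * h%:P + u%:P * t%:P * ((1 - 'X) * q).
    rewrite /s {1}qE mulrDr; congr (_ + _).
    by rewrite -!polyCM hE polyCD polyCM polyC_natr.
  rewrite !zp_evalD !zp_evalM zp_eval1 zp_eval_nat zp_evalXn piE pT -/pi.
  have -> : pi ^+ p.-1 = pi * pi ^+ p.-2 by rewrite -exprS; congr (_ ^+ _); lia.
  ring.
have [h hE] : exists h, ev s ^+ p = 1 + p%:R * ev h.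
  have [k kE] := exprD_prime (1 : {poly Zp}) ((1 - 'X) * b) p_pr.
  exists (r * b ^+ p + 1 * ((1 - 'X) * b) * k).
  have -> : ev s = ev (1 + (1 - 'X) * b) by rewrite bE zp_evalD zp_eval1 zp_evalM piE.
  rewrite -zp_evalXn kE expr1n exprMn !zp_evalD !zp_evalM !zp_evalXn zp_eval1 zp_eval_nat.
  by rewrite piE rE; ring.
have [S SE] := one_unit_root Lv (prime_gt0 p_pr) (prim_expr_order z_prim) hE.
have S0 : S != 0.
  apply/eqP => S0; have := SE; rewrite S0 expr0n.
  have -> : (p.-1 == 0)%N = false by lia.
  by rewrite mul0r => /eqP; rewrite eq_sym oner_eq0.
exists (pi / S); rewrite expr_div_n pT -/pi.
have -> : (S ^+ p.-1)^-1 = ev s.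
  by apply: (mulfI (expf_neq0 p.-1 S0)); rewrite SE divff // expf_neq0.
by rewrite /s !zp_evalM !zp_evalC; ring.
Qed.

End OddPrime.

(** * Transfer from the division algebra *)

Section CommutativeSubalgebra.
Context (K : fieldType) (D : falgType K) (E : {aspace D}).

(* A copy of subvs_of E whose field structure may depend on the hypotheses. *)
Definition comm_subalgebra (Ecomm : (E <= 'C(E))%VS) (E1 : 1 \in E)
  (D_unit : forall x : D, x != 0 -> x \is a GRing.unit) : Type := subvs_of E.

Context (Ecomm : (E <= 'C(E))%VS) (E1 : 1 \in E).
Context (D_unit : forall x : D, x != 0 -> x \is a GRing.unit).
Local Notation T := (comm_subalgebra Ecomm E1 D_unit).

HB.instance Definition _ := Falgebra.copy T (subvs_of E).

Lemma comm_subalgebra_mulC : commutative (@GRing.mul T).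
Proof.
move=> x y; apply: val_inj; rewrite /=.
by move/centvsP: Ecomm; apply; exact: subvsP.
Qed.

HB.instance Definition _ := GRing.PzRing_hasCommutativeMul.Build T comm_subalgebra_mulC.

Lemma comm_subalgebra_field : GRing.field_axiom T.
Proof.
move=> x x0; apply: (@vsval_unitr _ _ E x); apply: D_unit.
by apply: contra_neq x0 => x0; apply: val_inj.
Qed.

HB.instance Definition _ := GRing.ComUnitRing_isField.Build T comm_subalgebra_field.



Definition comm_subalgebra_val (x : T) : D := vsval x.

HB.instance Definition _ := GRing.Linear.copy comm_subalgebra_val (@vsval K D E).

Lemma comm_subalgebra_val_monoid : monoid_morphism comm_subalgebra_val.
Proof. by split=> //; apply/eqP; rewrite [_ == _]algid_eq1. Qed.

HB.instance Definition _ :=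
  GRing.isMonoidMorphism.Build T D comm_subalgebra_val comm_subalgebra_val_monoid.

Lemma comm_subalgebraP : exists (L : fieldExtType K) (tau : {lrmorphism L -> D}),
  forall x, x \in E <-> exists y, x = tau y.
Proof.
exists T, comm_subalgebra_val => x; split=> [xE|[y ->]]; last exact: subvsP.
by exists (vsproj E x); exact/esym/vsprojK.
Qed.

End CommutativeSubalgebra.

(** Multiplication by x permutes s; comparing the products over s gives x^|s| = 1, and the |s| roots
    of X^|s| - 1 in a field include a primitive one. *)
Lemma finite_mul_group_cyclic (L : fieldType) (s : seq L) : uniq s -> s != [::] ->
  0 \notin s -> {in s &, forall x y, x * y \in s} ->
  exists g, [/\ g \in s, (size s).-primitive_root g & {in s, forall x, x ^+ size s = 1}].
Proof.
move=> us s0 z0 sM; have ss : (0 < size s)%N by rewrite lt0n size_eq0.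
have sX : {in s, forall x, x ^+ size s = 1}.
  move=> x xs; have x0 : x != 0 by apply: contraNneq z0 => <-.
  have pm : perm_eq s [seq x * y | y <- s].
    have um : uniq [seq x * y | y <- s] by rewrite map_inj_uniq //; exact: mulfI.
    rewrite perm_sym; apply: uniq_perm => //; apply: (uniq_min_size um _ _).2.
      by move=> _ /mapP[y ys ->]; exact: sM.
    by rewrite size_map.
  have P0 : \prod_(y <- s) y != 0.
    by rewrite prodf_seq_neq0; apply/allP => y ys; apply/implyP => _; apply: contraNneq z0 => <-.
  apply: (mulIf P0); rewrite mul1r [in RHS](perm_big _ pm) big_map big_split /=.
  by rewrite big_const_seq count_predT iter_mulr_1.
have : has (size s).-primitive_root s.
  by apply: has_prim_root => //; apply/allP => x xs; rewrite unity_rootE sX.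
by move=> /hasP[g gs gp]; exists g.
Qed.

(* The valuations on W s^i are congruent to i / n modulo Z, so that the W s^i for i < n are
   in direct sum and fill D. *)
Lemma val_denominator (F : fieldType) (D : falgType F) (v : D -> rat) (W : {vspace D})
    (s : D) (n : nat) : division_valuation v -> (0 < n)%N ->
  \dim {:D} = (n ^ 2)%N -> \dim W = n ->
  (forall x, x \in W -> x != 0 -> v x \is a Num.int) ->
  s != 0 -> v s - n%:R^-1 \is a Num.int ->
  forall x, x != 0 -> n%:R * v x \is a Num.int.
Proof.
move=> vD n0 dD dW W_int s0 vs.
have D_unit : forall x : D, x != 0 -> x \is a GRing.unit by case: vD.
have nr : n%:R != 0 :> rat by rewrite pnatr_eq0 -lt0n.
have sX i : s ^+ i != 0 by apply: (div_expf_neq0 vD).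
pose V (i : 'I_n) := (W * <[s ^+ i]>)%VS.
have vV (i : 'I_n) x : x \in V i -> x != 0 ->
    exists2 y : rat, y \is a Num.int & n%:R * v x = i%:R + n%:R * y.
  move=> /memv_cosetP[w wW ->] x0.
  have w0 : w != 0 by apply: contra_neq x0 => ->; rewrite mul0r.
  exists (v w + i%:R * (v s - n%:R^-1)).
    by rewrite rpredD ?W_int // rpredM ?natr_int.
  by rewrite (pvalM vD) // (pvalX vD) //; field.
have sum_val (t : 'I_n -> D) : (forall i, t i \in V i) ->
    (forall i, t i = 0) \/ \sum_i t i != 0 /\ n%:R * v (\sum_i t i) \is a Num.int.
  move=> tV; have [|Z|[S0 [i [_ ti ->]]]] := pval_sum_distinct vD (t := t) (index_enum_uniq _).
  - move=> i k _ _ ti tk tik; apply: val_inj.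
    have [y yi Ei] := vV _ _ (tV i) ti; have [y' yi' Ek] := vV _ _ (tV k) tk.
    apply: (@ltn_int_multiple_eq _ _ n (y' - y) (ltn_ord _) (ltn_ord _)).
      by rewrite rpredB.
    by move: Ei; rewrite tik Ek; lra.
  - by left=> i; apply: Z; rewrite mem_index_enum.
  - right; split=> //; have [y yi ->] := vV _ _ (tV i) ti.
    by rewrite rpredD ?rpredM ?natr_int.
have dir : directv (\sum_(i < n) V i).
  apply/directv_sum_independent => t tV t0 i _.
  by have [->//|[]] := sum_val t (fun i => tV i isT); rewrite t0 eqxx.
have full : (\sum_(i < n) V i)%VS = fullv.
  apply/eqP; rewrite eqEdim subvf /= dD (directvP dir) /=.
  rewrite (eq_bigr (fun=> n)) ?sum_nat_const ?card_ord ?mulnn // => i _.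
  by rewrite dim_cosetv_unit // D_unit.
move=> x x0; have /memv_sumP[t tV xE] : x \in (\sum_(i < n) V i)%VS by rewrite full memvf.
have [Z|[_]] := sum_val t (fun i => tV i isT); last by rewrite -xE.
by move: x0; rewrite xE big1 ?eqxx.
Qed.

Lemma intr_divz (c : int) (k : nat) : (0 < k)%N ->
  exists (q : int) (i : nat), (i < k)%N /\ c%:~R = q%:~R * k%:R + i%:R :> rat.
Proof.
move=> k0; have m0 : (0 <= c %% k)%Z by rewrite modz_ge0 // eqz_nat -lt0n.
have mE : (`|(c %% k)%Z|%N : int) = (c %% k)%Z by rewrite gez0_abs.
exists (c %/ k)%Z, `|(c %% k)%Z|%N; split; first by rewrite -ltz_nat mE ltz_pmod.
by rewrite [in LHS](divz_eq c k) intrD intrM -[in LHS]mE.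
Qed.

Section MulSubgroup.
Context (p : nat) (p_pr : prime p) (D : falgType (padic p_pr)) (G : set D).
Context (G_sg : mul_subgroup G).

Lemma mul_subgroup1 : G 1.
Proof. by case: G_sg => _ [/set_mem]. Qed.

Lemma mul_subgroup_unit x : G x -> x \is a GRing.unit.
Proof. by case: G_sg => H _ /H. Qed.

Lemma mul_subgroup_div x y : G x -> G y -> G (x / y).
Proof. by case: G_sg => _ [_ H] /mem_set Gx /mem_set Gy; apply/set_mem/H. Qed.

Lemma mul_subgroupV x : G x -> G x^-1.
Proof. by move=> Gx; rewrite -[x^-1]mul1r; apply: mul_subgroup_div => //; exact: mul_subgroup1. Qed.

Lemma mul_subgroupM x y : G x -> G y -> G (x * y).
Proof. by move=> Gx Gy; rewrite -[y]invrK; apply: mul_subgroup_div => //; exact: mul_subgroupV. Qed.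

Lemma mul_subgroupX x k : G x -> G (x ^+ k).
Proof.
move=> Gx; elim: k => [|k IH]; first by rewrite expr0; exact: mul_subgroup1.
by rewrite exprS; exact: mul_subgroupM.
Qed.

Lemma mul_subgroupXz x (k : int) : G x -> G (x ^ k).
Proof.
move=> Gx; case: k => k; first by rewrite -exprnP; exact: mul_subgroupX.
by rewrite NegzE -exprnN; apply/mul_subgroupV/mul_subgroupX.
Qed.

Lemma mul_subgroup_neq0 x : G x -> x != 0.
Proof. by move=> /mul_subgroup_unit; apply: contraTneq => ->; rewrite unitr0. Qed.

End MulSubgroup.

Section Transfer.
Context (p : nat) (p_pr : prime p) (D : falgType (padic p_pr)) (v : D -> rat).
Context (vD : division_valuation v).
Implicit Types (T F G : set D).

(** Modulo Z, v identifies the cosets with (1/k)Z / Z, and the powers x^i with i < k represent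
    them. *)
Lemma card_cosets T G (x : D) k : mul_subgroup G ->
  (forall y z, G y -> G z -> coset T y = coset T z <-> v y - v z \is a Num.int) ->
  (0 < k)%N -> G x -> k%:R * v x = 1 -> (forall y, G y -> k%:R * v y \is a Num.int) ->
  (cosets G T #= `I_k)%card.
Proof.
move=> Gsg GT k0 Gx vx G_int.
have kr : k%:R != 0 :> rat by rewrite pnatr_eq0 -lt0n.
have GX i : G (x ^+ i) by exact: mul_subgroupX.
have x0 := mul_subgroup_neq0 Gsg Gx.
have -> : cosets G T = [set coset T (x ^+ i) | i in `I_k].
  apply/seteqP; split=> [_ [y Gy <-]|_ [i _ <-]]; last by exists (x ^+ i).
  have [c cE] := intrP (G_int y Gy).
  have [q [i [ik ci]]] := intr_divz c k0; exists i => //.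
  apply/GT => //; rewrite (pvalX vD) //.
  suff -> : i%:R * v x - v y = - q%:~R by rewrite rpredN intr_int.
  apply: (mulfI kr); rewrite mulrBr mulrCA vx cE ci; ring.
apply: inj_card_eq => i l /set_mem /= ik /set_mem /= lk.
move=> /GT; rewrite !(pvalX vD) // => /(_ (GX _) (GX _)) H.
apply: (@ltn_int_multiple_eq _ _ k _ ik lk H).
transitivity (i%:R * (k%:R * v x)); first by rewrite vx mulr1.
transitivity (l%:R * (k%:R * v x) + k%:R * (i%:R * v x - l%:R * v x)); first by ring.
by rewrite vx mulr1.
Qed.

Context (u : padic_int p_pr).
Let P : D := (zp_to_qp (p%:R * u))%:A.
Context (P0 : P != 0) (vP : v P = 1).
Context (F0 : set D) (F0_sg : mul_subgroup F0) (F0_val : forall f, F0 f -> v f = 0).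

Lemma P_central x : x * P = P * x.
Proof. by rewrite /P mulr_algl mulr_algr. Qed.

(** The values of v on [F1] form a discrete group containing v(P) = 1, hence (1/k)Z; counting cosets
    gives k = r. *)
Lemma calF_root n K r F1 : (0 < n)%N -> calF v n K (tilde u F0) r F1 ->
  exists x f, [/\ K x, F0 f & x ^+ r = f * P].
Proof.
move=> n0 [F1sg F1K tF1 [F1_int F1_coset] F1_card].
have nr : n%:R != 0 :> rat by rewrite pnatr_eq0 -lt0n.
have F1P : F1 P.
  by apply: tF1; exists 1; [exact: mul_subgroup1 | exists 1; rewrite // mul1r expr1z].
(* n v is integral on [F1]; the shift by one keeps the value positive. *)
pose S d := `[< exists2 x, F1 x & n%:R * v x = d.+1%:R >].
have : exists d, S d.
  by exists n.-1; apply/asboolP; exists P; rewrite // vP mulr1 prednK.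
move=> /ex_minnP[d /asboolP[x F1x vx] dmin].
have x0 := mul_subgroup_neq0 F1sg F1x.
have dvd y : F1 y -> exists q : int, n%:R * v y = q%:~R * d.+1%:R.
  move=> F1y; have y0 := mul_subgroup_neq0 F1sg F1y.
  have [c cE] := intrP (F1_int _ F1y); have [q [i [id ci]]] := intr_divz c (ltn0Sn d).
  exists q; have [i0|i0] := posnP i; first by rewrite cE ci i0 addr0.
  suff /dmin : S i.-1 by lia.
  have F1xq : F1 (x ^ q) by exact: mul_subgroupXz.
  apply/asboolP; exists (y / x ^ q); first exact: mul_subgroup_div.
  have xq0 := mul_subgroup_neq0 F1sg F1xq.
  have xqV : (x ^ q)^-1 != 0.
    by have := mul_subgroup_neq0 F1sg (mul_subgroupV F1sg F1xq).
  rewrite (pvalM vD) // (pvalV vD) // (pvalXz vD) // prednK //.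
  by rewrite mulrDr cE ci mulrN mulrCA vx; ring.
have [k nk] : exists k : nat, n%:R = k%:R * d.+1%:R :> rat.
  have [q qE] := dvd P F1P; rewrite vP mulr1 in qE.
  have /(@intr_inj rat) : (n : int)%:~R = (q * d.+1)%:~R :> rat by rewrite intrM.
  by case: q qE => q qE E; [exists q | lia].
have k0 : (0 < k)%N by rewrite lt0n; apply: contraNneq nr => k0; rewrite nk k0 mul0r.
have d0 : d.+1%:R != 0 :> rat by rewrite pnatr_eq0.
have kx : k%:R * v x = 1.
  by apply: (mulIf d0); rewrite mul1r -[RHS]vx nk; ring.
have k_int y : F1 y -> k%:R * v y \is a Num.int.
  move=> /dvd[q qE]; suff -> : k%:R * v y = q%:~R by rewrite intr_int.
  by apply: (mulIf d0); rewrite -qE nk; ring.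
have /card_eq_II kr : (`I_k #= `I_r)%card.
  apply: card_eq_trans F1_card; rewrite card_eq_sym.
  exact: card_cosets F1sg F1_coset k0 F1x kx k_int.
exists x; have F1xr : F1 (x ^+ r) by exact: mul_subgroupX.
(* Both have valuation 1. So x^r = P f P^l with f in F0, and comparing valuations gives l = 0. *)
have : coset (tilde u F0) (x ^+ r) = coset (tilde u F0) P.
  by apply/F1_coset => //; rewrite (pvalX vD) // -kr kx vP subrr.
move=> /(congr1 (fun A => A (x ^+ r))) /= xP.
have : coset (tilde u F0) P (x ^+ r).
  rewrite -xP; exists 1; rewrite ?mulr1 //; exists 1; first exact: mul_subgroup1.
  by exists 0; rewrite // mul1r expr0z.
move=> [_ [f F0f [l _ <-]]]; rewrite -/P => E.
have f0 := mul_subgroup_neq0 F0_sg F0f.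
have Pl : P ^ l != 0.
  by apply: (mul_subgroup_neq0 F1sg); exact: mul_subgroupXz.
have : v (x ^+ r) = 1 + l%:~R.
  rewrite -E (pvalM vD) ?(div_mulf_neq0 vD) // (pvalM vD) // (F0_val F0f).
  by rewrite (pvalXz vD) // vP add0r mulr1.
rewrite (pvalX vD) // -kr kx => l0.
have {l0} l0 : l = 0 by apply: (@intr_inj rat); move: l0; lra.
exists f; split => //; first exact: F1K.
by rewrite kr -E l0 expr0z mulr1 P_central.
Qed.

(** The group generated by F0 and x belongs to the set: it contains P = x^r / f0, and v(x) = 1/r.
    Computations take place in the commutative field L. *)
Lemma root_calF n (L : fieldExtType (padic p_pr)) (tau : {lrmorphism L -> D})
    (K : set D) (x f0 : L) r : (0 < r)%N ->
  (forall y, y != 0 -> n%:R * v y \is a Num.int) ->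
  (forall y, K y <-> exists z, y = tau z) -> F0 `<=` K ->
  F0 (tau f0) -> tau (x ^+ r) = P * tau f0 -> calF v n K (tilde u F0) r !=set0.
Proof.
move=> r0 v_int K_tau F0K F0f0 xr; pose Q : L := (zp_to_qp (p%:R * u))%:A.
have tQ : tau Q = P by rewrite /Q /P linearZ /= rmorph1.
have tau_inj y z : tau y = tau z -> y = z by exact: fmorph_inj.
have tauXz y k : tau (y ^ k) = tau y ^ k by exact: fmorphXz.
have tauX y k : tau (y ^+ k) = tau y ^+ k by exact: rmorphXn.
have tauM y z : tau (y * z) = tau y * tau z by exact: rmorphM.
have tauV y : tau y^-1 = (tau y)^-1 by exact: fmorphV.
have tau1 : tau 1 = 1 by exact: rmorph1.
have {xr} xr : x ^+ r = Q * f0 by apply: tau_inj; rewrite xr -tQ tauM.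
have tau_neq0 y : (tau y != 0) = (y != 0) by rewrite fmorph_eq0.
have f00 : f0 != 0 by rewrite -tau_neq0 (mul_subgroup_neq0 F0_sg).
have Q0 : Q != 0 by rewrite -tau_neq0 tQ.
have x0 : x != 0 by have := mulf_neq0 Q0 f00; rewrite -xr expf_eq0 r0.
have rr : r%:R != 0 :> rat by rewrite pnatr_eq0 -lt0n.
have vx : r%:R * v (tau x) = 1.
  rewrite -(pvalX vD) ?tau_neq0 // -tauX xr tauM (pvalM vD) ?tau_neq0 //.
  by rewrite tQ vP F0_val // addr0.
have F0_tau f : F0 f -> exists2 h, F0 (tau h) & f = tau h.
  by move=> F0f; have /K_tau[h E] := F0K _ F0f; exists h; rewrite -?E.
have F0_neq0 f : F0 (tau f) -> f != 0.
  by move=> F0f; rewrite -tau_neq0 (mul_subgroup_neq0 F0_sg).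
have tildeP y : tilde u F0 y <-> exists h k, F0 (tau h) /\ y = tau (h * Q ^ k).
  split=> [[f /F0_tau[h F0h ->] [k _ <-]]|[h [k [F0h ->]]]].
    by exists h, k; rewrite tauM tauXz tQ.
  by exists (tau h) => //; exists k; rewrite // tauM tauXz tQ.
pose F1 : set D := [set y | exists h k, F0 (tau h) /\ y = tau (h * x ^ k)].
have vF1 h k : F0 (tau h) -> v (tau (h * x ^ k)) = k%:~R * v (tau x).
  move=> F0h; have h0 : tau h != 0 by rewrite tau_neq0 F0_neq0.
  have xk0 : tau (x ^ k) != 0 by rewrite tau_neq0 expfz_neq0.
  by rewrite tauM (pvalM vD) // (F0_val F0h) add0r tauXz (pvalXz vD) ?tau_neq0.
have F1_sg : mul_subgroup F1.
  split; first move=> y [h [k [F0h ->]]].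
    by case: vD => H _ _; apply: H; rewrite tau_neq0 mulf_neq0 ?expfz_neq0 ?(F0_neq0 _ F0h).
  split=> [|_ _ /set_mem[h [k [F0h ->]]] /set_mem[h' [k' [F0h' ->]]]]; apply/mem_set.
    exists 1, 0; rewrite expr0z mulr1; split=> //.
    by rewrite tau1; exact: mul_subgroup1.
  exists (h / h'), (k - k'); split; first by rewrite tauM tauV; exact: mul_subgroup_div.
  rewrite -tauV -tauM expfzDr // -invr_expz invfM; congr (tau _); ring.
have tilde_F1 : tilde u F0 `<=` F1.
  move=> _ /tildeP[h [k [F0h ->]]]; exists (h * f0^-1 ^ k), (r%:Z * k); split.
    rewrite tauM tauXz tauV; apply: (mul_subgroupM F0_sg) => //.
    by apply: (mul_subgroupXz F0_sg); exact: (mul_subgroupV F0_sg).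
  rewrite -exprz_exp -exprnP xr expfzMl exprz_inv -invr_expz; congr (tau _).
  by rewrite [Q ^ k * _]mulrC mulrA divfK ?expfz_neq0.
have tildeM y z : tilde u F0 y -> tilde u F0 z -> tilde u F0 (y * z).
  move=> /tildeP[h [k [F0h ->]]] /tildeP[h' [k' [F0h' ->]]]; apply/tildeP.
  exists (h * h'), (k + k'); split; first by rewrite tauM; exact: mul_subgroupM.
  by rewrite -tauM expfzDr // mulrACA.
have tildeV y : tilde u F0 y -> exists2 z, tilde u F0 z & y * z = 1.
  move=> /tildeP[h [k [F0h ->]]]; exists (tau (h^-1 * Q ^ (- k))).
    apply/tildeP; exists h^-1, (- k); split=> //; rewrite tauV; exact: mul_subgroupV.
  rewrite -tauM mulrACA divff ?(F0_neq0 _ F0h) // -expfzDr // subrr expr0z mulr1.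
  exact: tau1.
have cosetM y t : tilde u F0 t -> coset (tilde u F0) (y * t) = coset (tilde u F0) y.
  move=> Tt; apply/seteqP; split=> _ [g Tg <-].
    by exists (t * g); rewrite ?mulrA //; exact: tildeM.
  have [t' Tt' tt'] := tildeV _ Tt.
  by exists (t' * g); [exact: tildeM | rewrite -mulrA (mulrA t) tt' mul1r].
have tilde1 : tilde u F0 1.
  by apply/tildeP; exists 1, 0; rewrite expr0z mulr1 tau1; split=> //; exact: mul_subgroup1.
have coset_val y z : F1 y -> F1 z ->
    coset (tilde u F0) y = coset (tilde u F0) z <-> v y - v z \is a Num.int.
  move=> F1y F1z; have y0 := mul_subgroup_neq0 F1_sg F1y.
  have z0 := mul_subgroup_neq0 F1_sg F1z; split=> [yz|].
    have : coset (tilde u F0) z y by rewrite -yz; exists 1; rewrite ?mulr1.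
    move=> [t /tildeP[h [k [F0h tE]]] zt].
    have h0 : tau h != 0 by rewrite tau_neq0 F0_neq0.
    have Qk0 : tau (Q ^ k) != 0 by rewrite tau_neq0 expfz_neq0.
    have vt : v t = k%:~R.
      rewrite tE tauM (pvalM vD) // (F0_val F0h) add0r tauXz (pvalXz vD) ?tau_neq0 //.
      by rewrite tQ vP mulr1.
    have t0 : t != 0 by rewrite tE tau_neq0 mulf_neq0 ?expfz_neq0 ?(F0_neq0 _ F0h).
    by rewrite -zt (pvalM vD) // vt addrC addKr intr_int.
  case: F1y F1z => h [k [F0h ->]] [h' [k' [F0h' ->]]]; rewrite !vF1 // => /intrP[c cE].
  (* Valuations differing by the integer c force exponents of x differing by rc, and x^(rc) = (Q
     f0)^c lies in the subgroup. *)
  have kk : k = k' + r%:Z * c.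
    apply: (@intr_inj rat); rewrite intrD intrM -cE -pmulrn.
    transitivity (k%:~R * (r%:R * v (tau x)) : rat); first by rewrite vx mulr1.
    transitivity (k'%:~R * (r%:R * v (tau x))
       + r%:R * (k%:~R * v (tau x) - k'%:~R * v (tau x))); first by ring.
    by rewrite vx mulr1.
  have -> : h * x ^ k = h' * x ^ k' * (h / h' * f0 ^ c * Q ^ c).
    rewrite kk expfzDr // -exprz_exp -exprnP xr expfzMl.
    by field; rewrite F0_neq0.
  rewrite tauM cosetM //; apply/tildeP; exists (h / h' * f0 ^ c), c; split=> //.
  rewrite !tauM tauV tauXz; apply: mul_subgroupM => //; last exact: mul_subgroupXz.
  exact: mul_subgroup_div.
exists F1; split=> //.
- by move=> _ [h [k [F0h ->]]]; apply/K_tau; exists (h * x ^ k).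
- by split=> // y F1y; apply: v_int; exact: (mul_subgroup_neq0 F1_sg).
- apply: (@card_cosets _ _ (tau x) r) => //.
  + by exists 1, 1; rewrite expr1z mul1r tau1; split=> //; exact: mul_subgroup1.
  + by move=> _ [h [k [F0h ->]]]; rewrite vF1 // mulrCA vx mulr1; exact: intr_int.
Qed.

End Transfer.

(** * Roots of pu in a cyclotomic field *)

Section CyclotomicField.
Context (p : nat) (p_pr : prime p).
Local Notation Zp := (padic_int p_pr).
Context (F : fieldType) (L : fieldExtType F) (j : {rmorphism Zp -> L}) (v : L -> rat).
Context (Lv : zp_field_ext j v).
Context (N : nat) (g : L) (g_prim : N.-primitive_root g) (gL : <<1; g>>%VS = fullv).
Context (u : Zp) (u_unit : u \is a GRing.unit).

Let vL : division_valuation v := zpf_val Lv.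
Let N_gt0 : (0 < N)%N := prim_order_gt0 g_prim.

(** As [g] generates F0, the right-hand sides run through pu F0. *)
Definition pu_root r := exists x k, x ^+ r = p%:R * j u * g ^+ k.

Lemma pu_neq0_val : p%:R * j u != 0 /\ v (p%:R * j u) = 1.
Proof.
have [u0 vu] := zpf_unit Lv u_unit; have p0 := zpf_p0 Lv.
by rewrite mulf_neq0 // (pvalM vL) // (zpf_vp Lv) vu addr0.
Qed.

Lemma pu_root1 : pu_root 1.
Proof. by exists (p%:R * j u), 0%N; rewrite expr1 expr0 mulr1. Qed.

Lemma pu_root_dvd r s : (r %| s)%N -> pu_root s -> pu_root r.
Proof. by move=> /dvdnP[q ->] [x [k xE]]; exists (x ^+ q), k; rewrite -exprM. Qed.

Lemma pu_root_val x r k : (0 < r)%N -> x ^+ r = p%:R * j u * g ^+ k ->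
  x != 0 /\ r%:R * v x = 1.
Proof.
move=> r0 xr; have [M0 vM] := pu_neq0_val.
have gk0 : g ^+ k != 0 by rewrite expf_neq0 // (prim_root_eq0 g_prim) -lt0n.
have x0 : x != 0 by have := mulf_neq0 M0 gk0; rewrite -xr expf_eq0 r0.
split=> //; rewrite -(pvalX vL) // xr (pvalM vL) // vM.
rewrite (pval_root1 vL N_gt0) ?addr0 //.
by rewrite exprAC (prim_expr_order g_prim) expr1n.
Qed.

Context (a m : nat) (NE : N = (p ^ a * m)%N) (pm : coprime p m).
Let w := g ^+ (p ^ a).
Let z := g ^+ m.

Let m_gt0 : (0 < m)%N. Proof. by move: N_gt0; rewrite NE; case: (m) => //; rewrite muln0. Qed.

Let wm : w ^+ m = 1. Proof. by rewrite -exprM -NE (prim_expr_order g_prim). Qed.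

Lemma p_part_prim : (p ^ a).-primitive_root z.
Proof.
have -> : z = g ^+ (N %/ p ^ a) by rewrite NE mulKn // expn_gt0 prime_gt0.
have dN : (p ^ a %| N)%N by rewrite NE dvdn_mulr.
exact: (dvdn_prim_root g_prim dN).
Qed.

Lemma generator_decomp k : exists k1 k2, g ^+ k = w ^+ k1 * z ^+ k2.
Proof.
case: (egcdnP (p ^ a) m_gt0) => km kn E _.
have cop : gcdn m (p ^ a) = 1%N by apply/eqP; rewrite gcdnC; exact: coprimeXl.
(* Bezout gives km * m = kn * p^a + 1, that is g = w^(-kn) z^km; the factor m - 1 replaces -1
   because w^m = 1. *)
rewrite cop in E; exists (kn * m.-1 * k)%N, (km * k)%N.
have w0 : w ^+ kn != 0.
  by rewrite expf_neq0 // expf_neq0 // (prim_root_eq0 g_prim) -lt0n.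
have zE : z ^+ km = w ^+ kn * g.
  by rewrite /z /w -!exprM mulnC E exprD expr1 mulnC.
rewrite [w ^+ _]exprM [z ^+ _]exprM zE -exprMn mulrA -exprD -mulnSr prednK //.
by rewrite mulnC exprM wm expr1n mul1r.
Qed.

Lemma adjoin_generators : <<<<1; w>>; z>>%VS = fullv.
Proof.
apply/eqP; rewrite eqEsubv subvf -gL /=; apply/FadjoinP; split; first exact: sub1v.
have [k1 [k2 ->]] : exists k1 k2, g = w ^+ k1 * z ^+ k2.
  by have [k1 [k2 E]] := generator_decomp 1; exists k1, k2; rewrite -E expr1.
have sub (E : {subfield L}) : w \in E -> z \in E -> w ^+ k1 * z ^+ k2 \in E.
  by move=> wE zE; apply: rpredM; exact: rpredX.
by apply: sub; [apply: subvP_adjoin | ]; exact: memv_adjoin.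
Qed.

Lemma unramified_pu_root r : z \in <<1; w>>%VS -> (0 < r)%N -> pu_root r -> r = 1%N.
Proof.
move=> zw r0 [x [k xr]]; have [x0 vx] := pu_root_val r0 xr.
have full : <<1; w>>%VS = fullv by rewrite -adjoin_generators; exact/esym/Fadjoin_idP.
have xw : x \in <<1; w>>%VS by rewrite full memvf.
have [c cE] := intrP (unramified_val_int Lv m_gt0 pm wm xw x0).
have : (r : int) * c = 1.
  by apply: (@intr_inj rat); rewrite intrM -cE.
by move=> /(congr1 absz) /eqP; rewrite abszM muln_eq1 => /andP[/eqP].
Qed.

(* The part of g^k of order prime to p is an r-th power. *)
Lemma pu_root_p_part r x k : coprime r m -> x ^+ r = p%:R * j u * g ^+ k ->
  exists y l, y ^+ r = p%:R * j u * z ^+ l.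
Proof.
move=> rm xr; have [k1 [k2 gE]] := generator_decomp k.
case: (egcdnP r m_gt0) => km kn E _.
have cop : gcdn m r = 1%N by apply/eqP; rewrite gcdnC.
rewrite cop in E; have wE : w * w ^+ (kn * r) = 1.
  by rewrite -exprS -addn1 -E mulnC exprM wm expr1n.
exists (x * w ^+ (kn * k1)), k2; rewrite exprMn xr gE -[(w ^+ (kn * k1)) ^+ r]exprM.
have -> : (kn * k1 * r = kn * r * k1)%N by rewrite mulnAC.
rewrite [w ^+ (kn * r * k1)]exprM.
transitivity (p%:R * j u * z ^+ k2 * (w ^+ k1 * (w ^+ (kn * r)) ^+ k1)).
  by ring.
by rewrite -exprMn wE expr1n mulr1.
Qed.

Let Mu : L := p%:R * j u.

Let Mu_in : Mu \in <<1; w>>%AS.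
Proof.
rewrite rpredM ?rpredMn ?rpred1 //.
exact: subvP (sub1v _) _ (zpf_base Lv u).
Qed.

(** r divides (p-1) p^b. If p divided r, a p-th root would exist, and its twist by a root of unity
    of order prime to p contradicts [no_pth_root]. *)
Lemma pu_root_odd b r : a = b.+1 -> (2 < p)%N -> (0 < r)%N -> pu_root r -> (r %| p - 1)%N.
Proof.
move=> ab p2 r0 rr; have [M0 vM] := pu_neq0_val.
have z_prim := p_part_prim; rewrite ab in z_prim.
have [x [k xr]] := rr; have [x0 vx] := pu_root_val r0 xr.
have := ramified_index Lv m_gt0 pm wm z_prim adjoin_generators r0 x0 vx.
rewrite totient_pfactor //= -subn1.
have [pr|npr] := boolP (p %| r)%N.
  have [y [l yE]] := pu_root_dvd pr rr.
  have [//|y' [l' yE']] := pu_root_p_part _ yE.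
  by have := no_pth_root Lv m_gt0 pm wm z_prim adjoin_generators Mu_in M0 vM p2 yE'.
by rewrite Gauss_dvdl // coprime_sym coprimeXl // prime_coprime.
Qed.

Lemma pu_root_even b r : a = b.+2 -> p = 2%N -> (0 < r)%N -> pu_root r -> (r %| 2)%N.
Proof.
move=> ab p2 r0 rr; have [M0 vM] := pu_neq0_val.
have z_prim := p_part_prim; rewrite ab in z_prim.
have [x [k xr]] := rr; have [x0 vx] := pu_root_val r0 xr.
have := ramified_index Lv m_gt0 pm wm z_prim adjoin_generators r0 x0 vx.
rewrite totient_pfactor //= p2 mul1n => /(dvdn_pfactor _ _ (isT : prime 2))[c _ rE].
have [c1|c2] := leqP c 1; first by rewrite rE (dvdn_exp2l 2 c1).
have r4 : (4 %| r)%N by rewrite rE (dvdn_exp2l 2 c2).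
have [y [l yE]] := pu_root_dvd r4 rr.
have [|y' [l' yE']] := pu_root_p_part _ yE.
  by apply: (@coprimeXl 2 2 m); rewrite -p2.
by have := no_4th_root Lv m_gt0 pm wm z_prim adjoin_generators Mu_in M0 vM p2
  (isT : 0 < b.+1)%N yE'.
Qed.

Lemma pu_sqrt b : a = b.+2 -> p = 2%N -> pu_root 2 ->
  exists2 y, y \in <<1; w>>%VS & y ^+ 2 = j u \/ y ^+ 2 = - j u.
Proof.
move=> ab p2 [x [k xE]]; have [M0 vM] := pu_neq0_val.
have z_prim := p_part_prim; rewrite ab in z_prim.
have [|y [l yE]] := pu_root_p_part _ xE; first by rewrite -p2.
have Mc : Mu = 2%:R * j u by rewrite /Mu [in X in X%:R * _]p2.
exact: (sqrt_unramified Lv m_gt0 pm wm z_prim adjoin_generators Mu_in M0 vM p2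
  (isT : 0 < b.+1)%N Mc yE).
Qed.

End CyclotomicField.

(** * The possible exponents r in terms of the order of F0 *)

Section PuRootClassification.
Context (p : nat) (p_pr : prime p).
Local Notation Zp := (padic_int p_pr).
Context (F : fieldType) (L : fieldExtType F) (j : {rmorphism Zp -> L}) (v : L -> rat).
Context (Lv : zp_field_ext j v).
Context (N : nat) (g : L) (g_prim : N.-primitive_root g) (gL : <<1; g>>%VS = fullv).
Context (u : Zp) (u_unit : u \is a GRing.unit).

Let N_gt0 : (0 < N)%N := prim_order_gt0 g_prim.

Lemma p_part_decomp : exists a m, N = (p ^ a * m)%N /\ coprime p m.
Proof. by have [m pm NE] := pfactor_coprime p_pr N_gt0; exists (logn p N), m; rewrite mulnC. Qed.

(** The p-part of g is then 1 or -1, already in the base field, so the whole field is unramified. *)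
Lemma pu_root_unramified r : (0 < r)%N -> ~~ (p %| N)%N \/ p = 2%N /\ ~~ (4 %| N)%N ->
  pu_root j g u r -> r = 1%N.
Proof.
move=> r0 H; have [a [m [NE pm]]] := p_part_decomp.
apply: (unramified_pu_root Lv g_prim gL u_unit NE pm) => //.
have z_prim := p_part_prim p_pr g_prim NE.
case: a NE z_prim H => [|[|a]] NE z_prim H.
- by have := prim_expr_order z_prim; rewrite expn0 expr1 => ->; exact: mem1v.
- case: H => [|[p2 _]]; first by rewrite NE expn1 dvdn_mulr.
  have := prim_expr_order z_prim; rewrite expn1 [in X in _ ^+ X]p2 => /eqP.
  rewrite -(expr1n L 2) eqf_sqr => /orP[] /eqP ->; first exact: mem1v.
  by rewrite rpredN; exact: mem1v.
- case: H => [|[p2]]; first by rewrite NE expnS -mulnA dvdn_mulr.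
  by rewrite NE p2 !expnS !mulnA -mulnA dvdn_mulr.
Qed.

Lemma pu_root_dvd_predp r : (2 < p)%N -> (p %| N)%N -> (0 < r)%N -> pu_root j g u r ->
  (r %| p - 1)%N.
Proof.
move=> p2 pN r0 rr; have [a [m [NE pm]]] := p_part_decomp.
case: a NE => [|a] NE.
  by move: pN; rewrite NE expn0 mul1n -[(_ %| _)%N]negbK -prime_coprime // pm.
exact: (pu_root_odd Lv g_prim gL u_unit NE pm erefl p2 r0 rr).
Qed.

Lemma dyadic_decomp : p = 2%N -> (4 %| N)%N ->
  exists b m, N = (p ^ b.+2 * m)%N /\ coprime p m.
Proof.
move=> p2 N4; have [[|[|b]] [m [NE pm]]] := p_part_decomp; last by exists b, m.
- by move: N4 pm; rewrite NE p2 coprime2n mul1n => /dvdnP[q ->]; rewrite oddM andbF.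
- by move: N4 pm; rewrite NE p2 coprime2n (@dvdn_pmul2l 2 2) // => /dvdnP[q ->]; rewrite oddM andbF.
Qed.

Lemma pu_root_dvd2 r : p = 2%N -> (4 %| N)%N -> (0 < r)%N -> pu_root j g u r -> (r %| 2)%N.
Proof.
move=> p2 N4 r0 rr; have [b [m [NE pm]]] := dyadic_decomp p2 N4.
exact: (pu_root_even Lv g_prim gL u_unit NE pm erefl p2 r0 rr).
Qed.

Lemma pu_root_predp t c i : (2 < p)%N -> (p %| N)%N -> u * t = - 1 + p%:R * c ->
  j t = g ^+ i -> pu_root j g u p.-1.
Proof.
move=> p2 pN ut jt; have z_prim := dvdn_prim_root g_prim pN.
by have [x xE] := exists_root_pu p2 Lv z_prim ut; exists x, i; rewrite xE jt.
Qed.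

End PuRootClassification.

Section DyadicClassification.
Context (p_pr : prime 2).
Local Notation Zp := (padic_int p_pr).
Context (F : fieldType) (L : fieldExtType F) (j : {rmorphism Zp -> L}) (v : L -> rat).
Context (Lv : zp_field_ext j v).
Context (N : nat) (g : L) (g_prim : N.-primitive_root g) (gL : <<1; g>>%VS = fullv).
Context (u : Zp) (u_unit : u \is a GRing.unit).

Lemma eqmod8_opp : eqmod_zp 8 (- u) 1 -> eqmod_zp 8 u (- 1).
Proof. by move=> [c E]; exists (- c); rewrite -[u]opprK E; ring. Qed.

Lemma pu_root2_mod8 : (4 %| N)%N -> pu_root j g u 2 ->
  (eqmod_zp 8 u 1 \/ eqmod_zp 8 u (- 1)) \/
  exists i P, 3.-primitive_root (zp_eval j (g ^+ i) P).
Proof.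
move=> N4 rr; have [b [m [NE pm]]] := dyadic_decomp p_pr g_prim erefl N4.
have [y yK yu] := pu_sqrt Lv g_prim gL u_unit NE pm erefl erefl rr.
have wm : (g ^+ (2 ^ b.+2)) ^+ m = 1 by rewrite -exprM -NE (prim_expr_order g_prim).
have m0 : (0 < m)%N.
  by have := prim_order_gt0 g_prim; rewrite NE; case: (m) => //; rewrite muln0.
have [yu1|yu1] := yu.
  have [|[P P3]] := unramified_sqrt_mod8 Lv u_unit m0 pm wm yK yu1; first by left; left.
  by right; exists (2 ^ b.+2)%N, P.
have Nu : - u \is a GRing.unit by rewrite unitrN.
have [||[P P3]] := unramified_sqrt_mod8 Lv Nu m0 pm wm yK.
- by rewrite yu1; exact/esym/rmorphN.
- by move=> /eqmod8_opp; left; right.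
- by right; exists (2 ^ b.+2)%N, P.
Qed.

Lemma pu_root2_exists : (4 %| N)%N ->
  (eqmod_zp 8 u 1 \/ eqmod_zp 8 u (- 1)) \/ (3 %| N)%N -> pu_root j g u 2.
Proof.
move=> N4 H; have i_prim := dvdn_prim_root g_prim N4; set i := g ^+ _ in i_prim.
have i2 : i ^+ 2 = - 1.
  have : (i ^+ 2) ^+ 2 == 1 ^+ 2 by rewrite -exprM (prim_expr_order i_prim) expr1n.
  by rewrite eqf_sqr -(prim_order_dvd i_prim) => /orP[|/eqP].
have [y yu] : exists y, y ^+ 2 = j u \/ y ^+ 2 = - j u.
  case: H => [[] [c uE]|N3].
  - by have [s sE] := zp2_sqrt uE; exists (j s); left; rewrite -rmorphXn sE.
  - have [|s sE] := @zp2_sqrt p_pr (- u) (- c); first by rewrite uE; ring.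
    by exists (j s); right; rewrite -rmorphXn sE rmorphN.
  - have q_prim := dvdn_prim_root g_prim N3; set q := g ^+ _ in q_prim.
    have q1 : q - 1 != 0.
      by rewrite subr_eq0 -[q]expr1 -(prim_order_dvd q_prim).
    have q3 : q ^+ 2 + q + 1 = 0.
      apply: (mulfI q1); rewrite mulr0.
      transitivity (q ^+ 3 - 1); first by ring.
      by rewrite (prim_expr_order q_prim) subrr.
    have [y yu] := cube_root_sqrt j u_unit q3.
    by exists y.
have := dyadic_extension i2 yu; rewrite /i -exprM.
(* The exponents express i and i^3 as powers of g. *)
by case=> E; exists ((1 + i) * y); [exists (N %/ 4)%N | exists (N %/ 4 * 3)%N]; rewrite E.
Qed.

End DyadicClassification.

(** * The field generated by F0 *)

Section Orders.
Context (p : nat) (p_pr : prime p) (D : falgType (padic p_pr)) (O : set D).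
Context (O_order : is_order O).

Lemma is_order1 : O 1.
Proof. by case: O_order => [[/set_mem]]. Qed.

Lemma is_orderB x y : O x -> O y -> O (x - y).
Proof. by case: O_order => [[_ H _] _] /mem_set Ox /mem_set Oy; apply/set_mem/H. Qed.

Lemma is_orderM x y : O x -> O y -> O (x * y).
Proof. by case: O_order => [[_ _ H] _] /mem_set Ox /mem_set Oy; apply/set_mem/H. Qed.

Lemma is_orderD x y : O x -> O y -> O (x + y).
Proof.
move=> Ox Oy; rewrite -[y]opprK -[- y]sub0r; apply: is_orderB => //; apply: is_orderB => //.
by rewrite -(subrr 1); apply: is_orderB; exact: is_order1.
Qed.

Lemma is_orderX x k : O x -> O (x ^+ k).
Proof.
move=> Ox; elim: k => [|k IH]; first by rewrite expr0; exact: is_order1.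
by rewrite exprS; exact: is_orderM.
Qed.

Lemma is_order_zp (c : padic_int p_pr) : O (zp_to_qp c)%:A.
Proof.
have := is_order1; case: O_order => _ [m [b [-> _]]] [d _ d1].
exists (fun i => c * d i) => //; rewrite -d1 scaler_sumr; apply: eq_bigr => i _.
by rewrite scalerA; congr (_ *: _); exact: rmorphM.
Qed.

End Orders.

Section Closure.
Context (p : nat) (p_pr : prime p) (D : falgType (padic p_pr)).

(** Since s is closed under products, its linear span is already the generated subalgebra; it is
    commutative inside a division ring, hence a field. *)
Lemma qp_adjoin_span (s : seq D) : (forall x : D, x != 0 -> x \is a GRing.unit) ->
  mul_subgroup [set` s] -> {in s &, forall x y, x * y = y * x} ->
  exists (L : fieldExtType (padic p_pr)) (tau : {lrmorphism L -> D}),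
    (forall y, qp_adjoin [set` s] y <-> exists x, y = tau x) /\
    (forall y, qp_adjoin [set` s] y <-> y \in <<s>>%VS).
Proof.
move=> D_unit s_sg sC; have sM x y : x \in s -> y \in s -> x * y \in s.
  exact: (mul_subgroupM s_sg).
have s1 : 1 \in s by exact: (mul_subgroup1 s_sg).
pose U := <<s>>%VS; have sU x : x \in s -> x \in U by exact: memv_span.
have UM : (U * U <= U)%VS.
  apply/prodvP => x y xU yU.
  have yM : {in s, forall b, b * y \in U}.
    move=> b bs; have : (U <= amull b @^-1: U)%VS.
      apply/span_subvP => c cs; rewrite -memv_preim lfunE /=.
      by apply: sU; exact: sM.
    by move=> /subvP /(_ _ yU); rewrite -memv_preim lfunE.
  have : (U <= amulr y @^-1: U)%VS.
    by apply/span_subvP => b bs; rewrite -memv_preim lfunE /=; exact: yM.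
  by move=> /subvP /(_ _ xU); rewrite -memv_preim lfunE.
have U_aspace : is_aspace U by rewrite /is_aspace UM andbT has_algid1 // sU.
pose E : {aspace D} := ASpace U_aspace.
have EC : (E <= 'C(E))%VS.
  apply/span_subvP => x xs; rewrite -subv_cent1; apply/span_subvP => y ys.
  by apply/cent1vP; rewrite sC.
have [L [tau tauP]] := comm_subalgebraP EC (sU _ s1) D_unit.
have KE y : qp_adjoin [set` s] y <-> y \in U.
  split.
    apply: (@smallest_sub _ _ _ [set y | y \in U]) => //=.
    split=> [|a x z /set_mem /= xU /set_mem /= zU|x z /set_mem /= xU /set_mem /= zU];
      apply/mem_set => /=.
    - exact: sU.
    - by rewrite rpredD ?rpredZ.
    - exact: (subvP UM) _ (memv_mul xU zU).
  move=> yU; rewrite (coord_span (X := in_tuple s) yU).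
  apply: (big_rec (fun y => qp_adjoin [set` s] y)) => [|i x _ Kx] A [Aalg As].
    (* Zero lies in A as -1 + 1. *)
    have [A1 AL _] := Aalg; have := AL (-1) 1 1 A1 A1.
    by rewrite scaleN1r addNr => /set_mem.
  have [A1 AL _] := Aalg; apply/set_mem/AL; apply/mem_set; last exact: Kx.
  by apply: As => /=; rewrite mem_nth.
exists L, tau; split=> // y; rewrite KE; exact: tauP.
Qed.

End Closure.

(** * From the division algebra to a valued cyclotomic field, and conclusion *)

Section Assembly.
Context (p : nat) (p_pr : prime p) (D : falgType (padic p_pr)) (v : D -> rat).
Context (D_unit : forall x : D, x != 0 -> x \is a GRing.unit).
Context (v_ext : extends_padic_val v).
Context (L : fieldExtType (padic p_pr)) (tau : {lrmorphism L -> D}).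

Let vD : division_valuation v := extends_padic_val_division v_ext D_unit.

Definition padic_alg : {rmorphism padic_int p_pr -> L} :=
  GRing.RMorphism.clone _ _ (in_alg L \o @zp_to_qp p p_pr) _.

Lemma tau_alg c : tau c%:A = c%:A.
Proof. by rewrite linearZ /= rmorph1. Qed.

Lemma tau_nat k : tau k%:R = k%:R.
Proof. exact: rmorph_nat. Qed.

Lemma padic_zp_field_ext : zp_field_ext padic_alg (fun x => v (tau x)).
Proof.
have tau_neq0 y : (tau y != 0) = (y != 0) by rewrite fmorph_eq0.
have tauM y z : tau (y * z) = tau y * tau z by exact: rmorphM.
have tauD y z : tau (y + z) = tau y + tau z by exact: rmorphD.
have p0 : p%:R != 0 :> L by rewrite -tau_neq0 tau_nat p_neq0.
split=> //.
- split=> [x|x y x0 y0|x y x0 y0 xy]; first by rewrite unitfE.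
    by rewrite tauM (pvalM vD) ?tau_neq0.
  by rewrite tauD (pvalD vD) ?tau_neq0 // -tauD tau_neq0.
- by rewrite tau_nat (pval_p v_ext).
- move=> c c0; rewrite -[padic_alg c]/(in_alg L (zp_to_qp c)) /= tau_alg.
  apply: (pval_zp_ge0 v_ext); apply: contra_neq c0 => ->; exact: rmorph0.
- move=> c; have [k [z kz]] := qp_pM c; exists k, z.
  rewrite -[RHS]/((zp_to_qp z)%:A) -kz -scalerA -!natrX scaler_nat mulr_natl //.
- by move=> c; apply: rpredZ; exact: mem1v.
Qed.

Lemma group_generator (s : seq D) : uniq s -> mul_subgroup [set` s] ->
  (forall y, y \in <<s>>%VS <-> exists x, y = tau x) ->
  exists N g, [/\ N.-primitive_root g, (forall y, y \in s <-> exists i, y = tau (g ^+ i))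
    & <<1; g>>%VS = fullv].
Proof.
move=> us s_sg tau_s.
have tau_inj y z : tau y = tau z -> y = z by exact: fmorph_inj.
have tauM y z : tau (y * z) = tau y * tau z by exact: rmorphM.
have tauX y k : tau (y ^+ k) = tau y ^+ k by exact: rmorphXn.
have /choice[h hP] : forall x : D, exists y : L, x \in s -> tau y = x.
  move=> x; have [xs|xs] := boolP (x \in s); last by exists 0.
  by have /tau_s[y ->] := memv_span xs; exists y.
have hs x : x \in s -> h x \in map h s by exact: map_f.
have [|||x y|g [gs g_prim sX]] := @finite_mul_group_cyclic L (map h s).
- by rewrite map_inj_in_uniq // => x y xs ys hxy; rewrite -(hP x xs) hxy hP.
- by case: (s) (mul_subgroup1 s_sg).
- apply/mapP => -[x xs x0]; have := mul_subgroup_neq0 s_sg xs.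
  by rewrite -(hP x xs) -x0 linear0 eqxx.
- move=> /mapP[x' xs ->] /mapP[y' ys ->].
  have xys : x' * y' \in s by exact: (mul_subgroupM s_sg xs ys).
  suff -> : h x' * h y' = h (x' * y') by exact: hs.
  by apply: tau_inj; rewrite tauM !hP.
have s_pow y : y \in s <-> exists i, y = tau (g ^+ i).
  split=> [ys|[i ->]].
    by have [i E] := prim_rootP g_prim (sX _ (hs _ ys)); exists i; rewrite -E hP.
  case/mapP: gs => g' g's ->; rewrite tauX hP //; exact: (@mul_subgroupX _ _ _ _ s_sg g' i g's).
exists (size (map h s)), g; split=> //.
apply/eqP; rewrite eqEsubv subvf /=; apply/subvP => y _.
have : (<<s>> <= linfun tau @: <<1; g>>)%VS.
  apply/span_subvP => _ /s_pow[i ->]; rewrite -[tau _]lfunE; apply: memv_img.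
  by apply: (@rpredX _ <<1; g>>%AS); exact: memv_adjoin.
move=> /subvP /(_ (tau y)) H; have /H/memv_imgP[z zg] : tau y \in <<s>>%VS.
  by apply/tau_s; exists y.
by rewrite lfunE /= => /tau_inj ->.
Qed.

Lemma calF_pu_root n r (u : padic_int p_pr) (F0 : set D) N (g : L) :
  (0 < n)%N -> (0 < r)%N -> u \is a GRing.unit -> mul_subgroup F0 ->
  (forall y, y != 0 -> n%:R * v y \is a Num.int) ->
  N.-primitive_root g -> (forall y, F0 y <-> exists i, y = tau (g ^+ i)) ->
  (forall y, qp_adjoin F0 y <-> exists x, y = tau x) ->
  calF v n (qp_adjoin F0) (tilde u F0) r !=set0 <-> pu_root padic_alg g u r.
Proof.
move=> n0 r0 u_unit F0_sg v_int g_prim F0g Ktau.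
have tau_inj y z : tau y = tau z -> y = z by exact: fmorph_inj.
have tauM y z : tau (y * z) = tau y * tau z by exact: rmorphM.
have tauX y k : tau (y ^+ k) = tau y ^+ k by exact: rmorphXn.
have ME : p%:R * padic_alg u = (zp_to_qp (p%:R * u))%:A.
  by rewrite -[RHS]/(padic_alg (p%:R * u)) rmorphM rmorph_nat.
have [M0 vM] := pu_neq0_val padic_zp_field_ext u_unit; rewrite ME tau_alg in vM.
have P0 : (zp_to_qp (p%:R * u))%:A != 0 :> D by rewrite -tau_alg fmorph_eq0 -ME.
have F0_val f : F0 f -> v f = 0.
  move=> /F0g[i ->]; apply: (pval_root1 vD (prim_order_gt0 g_prim)).
  rewrite -tauX exprAC (prim_expr_order g_prim) expr1n; exact: rmorph1.
split=> [[F1 /(calF_root vD P0 vM F0_sg F0_val n0)[x [f [Kx F0f xr]]]]|[x [k xr]]].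
  have /Ktau[x' x'E] := Kx; have /F0g[i fE] := F0f.
  exists x', i; apply: tau_inj; rewrite tauX -x'E xr fE tauM ME tau_alg.
  exact: P_central.
apply: (root_calF vD P0 vM F0_sg F0_val r0 v_int Ktau (x := x) (f0 := g ^+ k)).
- by apply: sub_gen_smallest.
- by apply/F0g; exists k.
- by rewrite xr tauM ME tau_alg.
Qed.

End Assembly.

(** The products g^k y^l form a finite abelian group of units of O containing F0, so they are all in
    F0 by maximality. *)
Lemma maximal_root_of_unity (p : nat) (p_pr : prime p) (D : falgType (padic p_pr))
    (O F0 : set D) (L : fieldExtType (padic p_pr)) (tau : {lrmorphism L -> D})
    (N : nat) (g y : L) (M : nat) :
  (forall x : D, x != 0 -> x \is a GRing.unit) -> is_order O ->
  maximal_finite_abelian_subgroup_of (ring_units O) F0 ->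
  N.-primitive_root g -> (forall x, F0 x <-> exists i, x = tau (g ^+ i)) ->
  (0 < M)%N -> y ^+ M = 1 -> O (tau y) -> exists i, y = g ^+ i.
Proof.
move=> D_unit O_order [[F0_sg F0_O _ _] F0_max] g_prim F0g M0 yM Oy.
have tau_inj x z : tau x = tau z -> x = z by exact: fmorph_inj.
have tauM x z : tau (x * z) = tau x * tau z by exact: rmorphM.
have tauX x k : tau (x ^+ k) = tau x ^+ k by exact: rmorphXn.
have tauV x : tau x^-1 = (tau x)^-1 by exact: fmorphV.
have N0 := prim_order_gt0 g_prim; have gN := prim_expr_order g_prim.
have y0 : y != 0.
  by apply/eqP => y0; move/eqP: yM; rewrite y0 expr0n eqn0Ngt M0 eq_sym oner_eq0.
have g0 : g != 0 by rewrite (prim_root_eq0 g_prim) -lt0n.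
have tau_neq0 x : (tau x != 0) = (x != 0) by rewrite fmorph_eq0.
pose e k l : L := g ^+ k * y ^+ l.
pose F1 := [set tau (e k l) | k in `I_N & l in `I_M].
have F1P k l : F1 (tau (e k l)).
  exists (k %% N)%N; first by rewrite /= ltn_mod.
  exists (l %% M)%N; first by rewrite /= ltn_mod.
  by rewrite /e (expr_mod _ gN) (expr_mod _ yM).
have e0 k l : e k l != 0 by rewrite mulf_neq0 ?expf_neq0.
have F1_div x z : F1 x -> F1 z -> F1 (x / z).
  move=> [k _ [l _ <-]] [k' k'N [l' l'M <-]].
  suff -> : tau (e k l) / tau (e k' l') = tau (e (k + (N - k')) (l + (M - l')))%N by [].
  rewrite -tauV -tauM; congr (tau _); apply: (mulIf (e0 k' l')); rewrite divfK //.
  rewrite /e mulrACA -!exprD -!addnA !subnK ?(ltnW k'N) ?(ltnW l'M) //.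
  by rewrite !exprD gN yM !mulr1.
have F1_1 : F1 1.
  by have := F1P 0%N 0%N; rewrite /e !expr0 mulr1; suff -> : tau 1 = 1 by []; exact: rmorph1.
have F1_sg : mul_subgroup F1.
  split=> [_ [k _ [l _ <-]]|]; first by apply: D_unit; rewrite tau_neq0.
  by split=> [|x z /set_mem F1x /set_mem F1z]; apply/mem_set => //; exact: F1_div.
have F1_O : F1 `<=` O.
  move=> _ [k _ [l _ <-]].
  have /F0_O[Og _ _] : F0 (tau g) by apply/F0g; exists 1%N; rewrite expr1.
  rewrite /e tauM !tauX.
  by apply: (is_orderM O_order); apply: (is_orderX O_order).
have F0_F1 : F0 `<=` F1.
  by move=> x /F0g[i ->]; have := F1P i 0%N; rewrite /e expr0 mulr1.
have F1E : F1 = F0.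
  apply: F0_max => //; split=> //.
  - move=> x F1x; split; [exact: F1_O | exact: (mul_subgroup_unit F1_sg) |].
    by apply: F1_O; exact: (mul_subgroupV F1_sg).
  - by apply: finite_image2; exact: finite_II.
  - by move=> _ _ [k _ [l _ <-]] [k' _ [l' _ <-]]; rewrite -!tauM mulrC.
have /F0g[i yE] : F0 (tau y).
  by rewrite -F1E; have := F1P 0%N 1%N; rewrite /e expr0 expr1 mul1r.
by exists i; exact: tau_inj.
Qed.

(** This eliminates D: the theorem becomes a statement on [pu_root] and on the order N of F0. The
    last clause retains from maximality that roots of unity in Z_p[g^i] are powers of g. *)
Lemma cyclotomic_model (p : nat) (p_pr : prime p) (n : nat) (n_gt0 : (0 < n)%N)
    (D : falgType (padic p_pr)) (v : D -> rat) (O : set D)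
    (D_cda : central_division_algebra D) (D_dim : \dim {:D} = (n ^ 2)%N)
    (v_ext : extends_padic_val v) (D_hasse : has_hasse_invariant v n n%:R^-1)
    (O_max : is_maximal_order O)
    (u : padic_int p_pr) (u_unit : u \is a GRing.unit)
    (F0 : set D) (F0_max : maximal_finite_abelian_subgroup_of (ring_units O) F0) :
  exists (F : fieldType) (L : fieldExtType F) (j : {rmorphism padic_int p_pr -> L})
    (w : L -> rat) (N : nat) (g : L),
  [/\ zp_field_ext j w /\ N.-primitive_root g, <<1; g>>%VS = fullv,
      forall r, (0 < r)%N ->
        (calF v n (qp_adjoin F0) (tilde u F0) r !=set0 <-> pu_root j g u r),
      forall i, (0 < i)%N -> (has_zeta i F0 <-> (i %| N)%N)
    & forall i P M, (0 < M)%N -> zp_eval j (g ^+ i) P ^+ M = 1 ->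
        exists k, zp_eval j (g ^+ i) P = g ^+ k].
Proof.
have [D_unit _] := D_cda; have [O_order _] := O_max.
have vD := extends_padic_val_division v_ext D_unit.
have v_int : forall x, x != 0 -> n%:R * v x \is a Num.int.
  have [W [s [[_ dW W_int] [s0 _ _] vs]]] := D_hasse.
  exact: (val_denominator vD n_gt0 D_dim dW W_int s0 vs).
have [[F0_sg F0_O /finite_seqP[s0 F0E] F0_comm] _] := F0_max.
pose s := undup s0; have {}F0E : F0 = [set` s].
  by rewrite F0E; apply/seteqP; split=> x /=; rewrite mem_undup.
have s_sg : mul_subgroup [set` s] by rewrite -F0E.
have sC : {in s &, forall x y, x * y = y * x}.
  by move=> x y xs ys; apply: F0_comm; rewrite F0E.
have [L [tau [Ktau KU]]] := qp_adjoin_span D_unit s_sg sC.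
have [|N [g [g_prim sg gL]]] := group_generator (tau := tau) (undup_uniq s0) s_sg.
  by move=> y; rewrite -KU.
have F0g y : F0 y <-> exists i, y = tau (g ^+ i) by rewrite F0E; exact: sg.
have tau_neq0 x : (tau x != 0) = (x != 0) by rewrite fmorph_eq0.
exists (padic p_pr), L, (@padic_alg p p_pr L), (fun x => v (tau x)), N, g; split=> //.
- by split=> //; exact: padic_zp_field_ext.
- move=> r r0.
  apply: (calF_pu_root D_unit v_ext n_gt0 r0 u_unit F0_sg v_int g_prim F0g).
  by rewrite F0E; exact: Ktau.
- move=> i i0; split=> [[_ /F0g[k ->] ki]|iN].
    have {}ki : i.-primitive_root (g ^+ k) by rewrite -(fmorph_primitive_root tau).
    by rewrite (prim_order_dvd ki) exprAC (prim_expr_order g_prim) expr1n.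
  exists (tau (g ^+ (N %/ i))); first by apply/F0g; exists (N %/ i)%N.
  by rewrite fmorph_primitive_root; exact: (dvdn_prim_root g_prim iN).
- move=> i P M M0 zM.
  apply: (maximal_root_of_unity D_unit O_order F0_max g_prim F0g M0 zM).
  have Og : O (tau (g ^+ i)).
    have /F0_O[] // : F0 (tau (g ^+ i)) by apply/F0g; exists i.
  (* Z_p[g^i] lies in O, an order containing both Z_p and F0. *)
  elim/poly_ind: P {zM} => [|P c IH].
    rewrite rmorph0 linear0 -(subrr 1).
    by apply: (is_orderB O_order); exact: (is_order1 O_order).
  rewrite zp_evalD zp_evalM zp_evalX zp_evalC linearD /=; apply: (is_orderD O_order).
    by rewrite rmorphM; exact: (is_orderM O_order).
  suff : O (tau (zp_to_qp c)%:A) by [].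
  by rewrite tau_alg; exact: (is_order_zp O_order).
Qed.

Theorem mainTheorem3
    (p : nat) (p_pr : prime p) (n : nat) (n_gt0 : (0 < n)%N)
    (D : falgType (padic p_pr)) (v : D -> rat) (O : set D)
    (D_cda : central_division_algebra D) (D_dim : \dim {:D} = (n ^ 2)%N)
    (v_ext : extends_padic_val v) (D_hasse : has_hasse_invariant v n n%:R^-1)
    (O_max : is_maximal_order O)
    (u : padic_int p_pr) (u_unit : u \is a GRing.unit)
    (F0 : set D) (F0_max : maximal_finite_abelian_subgroup_of (ring_units O) F0)
    (r1 : nat) (r1_gt0 : (0 < r1)%N) :
  let nonempty := calF v n (qp_adjoin F0) (tilde u F0) r1 !=set0 in
  let u_pm1_mod8 := eqmod_zp 8 u 1 \/ eqmod_zp 8 u (- 1) in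
  [/\ ((2 < p)%N /\ ~ has_zeta p F0 -> (nonempty <-> (r1 %| 1)%N)),
      ((2 < p)%N /\ has_zeta p F0 -> (nonempty <-> (r1 %| p - 1)%N)),
      (p = 2%N /\ ((~ has_zeta 3 F0 /\ ~ u_pm1_mod8) \/ ~ has_zeta 4 F0) ->
        (nonempty <-> (r1 %| 1)%N))
    & (p = 2%N /\ has_zeta 4 F0 /\ (u_pm1_mod8 \/ has_zeta 3 F0) ->
        (nonempty <-> (r1 %| 2)%N))].
Proof.
move=> nonempty u_pm1_mod8; rewrite /nonempty /u_pm1_mod8 => {nonempty u_pm1_mod8}.
have [F [L [j [w [N [g [[Lw g_prim] gL ne zeta max]]]]]]] :=
  cyclotomic_model n_gt0 D_cda D_dim v_ext D_hasse O_max u_unit F0_max.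
have {}ne := ne r1 r1_gt0.
have to_one : (pu_root j g u r1 -> r1 = 1%N) ->
    (calF v n (qp_adjoin F0) (tilde u F0) r1 !=set0 <-> (r1 %| 1)%N).
  move=> H; rewrite ne dvdn1; split=> [/H -> //|/eqP ->]; exact: pu_root1.
have p0 := prime_gt0 p_pr.
split.
- move=> [p2 Np]; apply: to_one; apply: (pu_root_unramified Lw g_prim gL u_unit) => //.
  by left; apply/negP => /(zeta p p0).
- move=> [p2 /(zeta p p0) pN]; rewrite ne; split=> [|dr].
    exact: (pu_root_dvd_predp Lw g_prim gL u_unit).
  apply: pu_root_dvd dr _; rewrite subn1.
  have Vu : - u^-1 \is a GRing.unit by rewrite unitrN unitrV.
  (* t is the root of unity congruent to -1/u, so ut = -1 modulo p. As an element of Z_p, a value of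
     a constant polynomial, it is a power of g by maximality. *)
  have [t [c [tp tc]]] := zp_teichmuller Vu.
  have ut : u * t = - 1 + p%:R * (u * c).
    by rewrite tc mulrDr mulrN divrr // mulrCA.
  have jt : zp_eval j (g ^+ 0) t%:P ^+ p.-1 = 1 by rewrite zp_evalC -rmorphXn tp rmorph1.
  have [|i] := max _ _ _ _ jt; first by lia.
  rewrite zp_evalC => jtE.
  exact: (pu_root_predp Lw g_prim p2 pN ut jtE).
- move=> [p2 H]; have [N4|N4] := boolP (4 %| N)%N; last first.
    by apply: to_one; apply: (pu_root_unramified Lw g_prim gL u_unit) => //; right.
  subst p; case: H => [[N3 Npm]|/(_ (proj2 (zeta 4 isT) N4))//].
  apply: to_one => rr; have := pu_root_dvd2 Lw g_prim gL u_unit erefl N4 r1_gt0 rr.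
  have [_ /(_ r1)] := primeP (isT : prime 2) => /[apply] /orP[/eqP //|/eqP r2].
  (* For r1 = 2 and u not 1 or -1 modulo 8, a primitive cube root of unity appears in Z_2[g^i];
     maximality puts it in F0, against the hypothesis. *)
  rewrite r2 in rr; have [//|[i [P P3]]] := pu_root2_mod8 Lw g_prim gL u_unit N4 rr.
  have [k kE] := max _ _ _ (isT : 0 < 3)%N (prim_expr_order P3).
  case: N3; apply/(zeta 3 isT); rewrite (prim_order_dvd P3) kE exprAC.
  by rewrite (prim_expr_order g_prim) expr1n.
- move=> [p2 [/(zeta 4 isT) N4 H]]; subst p; rewrite ne; split=> [|dr].
    exact: (pu_root_dvd2 Lw g_prim gL u_unit).
  apply: pu_root_dvd dr _; apply: (pu_root2_exists j g_prim u_unit N4).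
  by case: H => [|/(zeta 3 isT)]; [left|right].
Qed.
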